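(* Let $\mu$ be any probability measure on $\mathcal{C}_{x_0}M$ with the property that there exists a positive function $u\in\mathbb{D}^{1,2}$ such that $$\mathrm{Ent}(f^2)\leqslant\int u^2|\nabla f|^2\,d\mu\qquad\text{for all } f\in\mathbb{D}^{1,2}\cap L_\infty .$$ Assume furthermore that $|\nabla u|\leqslant a$ ($\mu$-almost surely) and $\int e^{Cu^2}d\mu<\infty$ for some constants $C,a>0$. Then there exist constants $C'>0$, $r_0>0$ and a function $\beta:(0,\infty)\to[0,\infty)$ with $\beta(s)=C'|\log s|$ for $0<s<r_0$ such that, for all $f\in\mathbb{D}^{1,2}\cap L_\infty$ and all $s>0$, $$\mathrm{Ent}(f^2)\leqslant\beta(s)\int|\nabla f|^2\,d\mu+s|f|_\infty^2 .$$
   Context: Fix $T>0$, a smooth finite dimensional, stochastically complete Riemannian manifold $M$, and $x_0\in M$. Let $\mathcal{C}_{x_0}M=\{\sigma:[0,T]\to M \text{ continuous},\ \sigma(0)=x_0\}$ with the uniform distance. Let $\mu$ be a Borel probability measure on $\mathcal{C}_{x_0}M$, possibly concentrated on a subspace such as the loop space $\{\sigma:\sigma(T)=x_0\}$. Integrals with respect to $\mu$ are denoted $\mathbf{E}$, and $\mathrm{Ent}(g)=\mathbf{E}\,g\log\frac{g}{\mathbf{E}g}$ for $g\geqslant0$. $L_\infty=L^\infty(\mu)$, with norm $|\cdot|_\infty$. Fix a metric connection on $M$ with skew-symmetric torsion and let $/\!/_s:T_{x_0}M\to T_{\sigma(s)}M$ be the ($\mu$-a.s. defined) parallel translation along $\sigma$.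 The Bismut tangent space is $$H_\sigma=\{(/\!/_sk_s)_{0\leqslant s\leqslant T}:k\in L_0^{2,1}(T_{x_0}M)\},\qquad \langle/\!/_\cdot k,/\!/_\cdot l\rangle_{H_\sigma}=\int_0^T\langle\dot k_s,\dot l_s\rangle ds,$$ where $L_0^{2,1}(T_{x_0}M)$ is the Cameron-Martin space of absolutely continuous paths $k:[0,T]\to T_{x_0}M$ with $k_0=0$ and $\int_0^T|\dot k_s|^2ds<\infty$ (with in addition $k_T=0$ when $\mu$ is carried by paths with fixed end point). A smooth cylindrical function is $F(\sigma)=f(\sigma_{s_1},\dots,\sigma_{s_k})$, $f\in C_K^\infty(M^k)$ (smooth, compactly supported), $0<s_1<\dots<s_k\leqslant t$ for some $t<T$. Its differential is $dF(\sigma)(h)=\sum_i\partial_if(\sigma_{s_1},\dots,\sigma_{s_k})(h_{s_i})$ for $h\in H_\sigma$, and $\nabla F(\sigma)\in H_\sigma$ is defined by $\langle\nabla F(\sigma),h\rangle_{H_\sigma}=dF(\sigma)(h)$. Standing assumption: this operator is closable in $L^2(\mu)$ (which holds when Driver's integration by parts formula holds). $\mathbb{D}^{1,2}$ is the closure of the smooth cylindrical functions under the graph norm $\big(\int|\nabla f|_{H_\sigma}^2d\mu+\int f^2d\mu\big)^{1/2}$, $\nabla$ also denotes the closed operator, and $|\nabla f|=|\nabla f|_{H_\sigma}$. *)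

(* Defs.v *)
From HB Require Import structures.
From mathcomp Require Import all_boot all_order all_algebra.
From mathcomp Require Import all_classical all_reals all_analysis.

Set Implicit Arguments.
Unset Strict Implicit.
Unset Printing Implicit Defensive.

Import Order.TTheory GRing.Theory Num.Theory.
Import numFieldNormedType.Exports.

Local Open Scope classical_set_scope.
Local Open Scope ring_scope.

Fixpoint Ck (R : realType) (k m n : nat) (U : set 'M[R]_(m, n))
    (f : 'M[R]_(m, n) -> R) : Prop :=
  (forall x, U x -> {for x, continuous f}) /\
  match k with
  | 0 => True
  | k'.+1 => forall i j,
      (forall x, U x -> derivable f x (delta_mx i j)) /\
      Ck k' U (fun x => 'D_(delta_mx i j) f x)
  end.

Definition smooth_on (R : realType) (m n : nat) (U : set 'M[R]_(m, n))
    (f : 'M[R]_(m, n) -> R) : Prop := forall k, Ck k U f.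

(* [bwd] is the inverse chart; its values outside [fwd @` dom] are junk *)
Record chart (R : realType) (n : nat) (M : metricType R) := Chart {
  dom : set M;
  fwd : M -> 'rV[R]_n;
  bwd : 'rV[R]_n -> M;
  dom_open : open dom;
  codom_open : open (fwd @` dom);
  fwdK : forall x, dom x -> bwd (fwd x) = x;
  fwd_continuous : forall x, dom x -> {for x, continuous fwd};
  bwd_continuous : forall y, (fwd @` dom) y -> {for y, continuous bwd}
}.

Definition codom (R : realType) n (M : metricType R) (c : chart n M) :
  set 'rV[R]_n := fwd c @` dom c.

(* The tangent space T_x M is modelled by 'rV[R]_n: a row vector v stands for
   the tangent vector \sum_i v_i d/dx^i, where the x^i are the coordinates of
   the preferred chart [chart_at x]. In particular a vector field is a function
   M -> 'rV[R]_n, read at each x in the chart [chart_at x]; nothing is required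
   of the way [chart_at x] depends on x. *)
Record smooth_structure (R : realType) (n : nat) (M : metricType R) :=
    SmoothStructure {
  atlas : set (chart n M);
  chart_at : M -> chart n M;
  chart_at_atlas : forall x, atlas (chart_at x);
  chart_at_dom : forall x, dom (chart_at x) x;
  transition_smooth : forall c c', atlas c -> atlas c' -> forall j,
    smooth_on (fwd c @` (dom c `&` dom c')) (fun y => fwd c' (bwd c y) 0 j);
  smooth_second_countable : @second_countable M
}.

Section Manifold.
Context (R : realType) (n : nat) (M : metricType R).
Variable S : smooth_structure n M.
Implicit Types (x : M) (v w : 'rV[R]_n) (f : M -> R) (c : chart n M).

(* df_x(v) *)
Definition dfun f x v : R :=
  'D_v (f \o bwd (chart_at S x)) (fwd (chart_at S x) x).

(* the components in the chart c of v, tangent at x *)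
Definition chart_coord c x v : 'rV[R]_n :=
  \row_i dfun (fun y => fwd c y 0 i) x v.

(* the i-th coordinate vector field of the chart c, at x *)
Definition chart_frame c x (i : 'I_n) : 'rV[R]_n :=
  \row_l 'D_(delta_mx 0 i) (fun y => fwd (chart_at S x) (bwd c y) 0 l)
           (fwd c x).

Definition smooth_fun f : Prop :=
  forall c, atlas S c -> smooth_on (codom c) (f \o bwd c).

Definition smooth_vf (X : M -> 'rV[R]_n) : Prop :=
  forall c, atlas S c -> forall i,
    smooth_on (codom c)
      (fun y => chart_coord c (bwd c y) (X (bwd c y)) 0 i).

Definition compactly_supported f : Prop :=
  compact (closure [set x | f x != 0]).

Definition lie (X Y : M -> 'rV[R]_n) x : 'rV[R]_n :=
  let coord (Z : M -> 'rV[R]_n) l y :=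
    dfun (fun z => fwd (chart_at S x) z 0 l) y (Z y) in
  \row_l (dfun (coord Y l) x (X x) - dfun (coord X l) x (Y x)).

Definition smooth_prod (k : nat) (f : {ptws 'I_k -> M} -> R) : Prop :=
  forall c : 'I_k -> chart n M, (forall i, atlas S (c i)) ->
    smooth_on [set y : 'M[R]_(k, n) | forall i, codom (c i) (row i y)]
      (fun y => f (fun i => bwd (c i) (row i y))).

Definition C1_curve (gamma : R -> M) : Prop :=
  continuous gamma /\
  forall c, atlas S c -> forall i t, dom c (gamma t) ->
    let p := fun s => fwd c (gamma s) 0 i in
    derivable p t 1 /\ {for t, continuous (derive1 p)}.

Definition velocity (gamma : R -> M) (t : R) : 'rV[R]_n :=
  \row_i derive1 (fun s => fwd (chart_at S (gamma t)) (gamma s) 0 i) t.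

End Manifold.

Definition bilin (R : realType) (n : nat) (G : 'M[R]_n) (v w : 'rV[R]_n) : R :=
  (v *m G *m w^T) 0 0.

Definition curve_length (R : realType) n (M : metricType R)
    (S : smooth_structure n M) (gram : M -> 'M[R]_n) (gamma : R -> M) : \bar R :=
  (\int[lebesgue_measure]_(t in `[0%R, 1%R])
     (Num.sqrt (bilin (gram (gamma t)) (velocity S gamma t)
                                       (velocity S gamma t)))%:E)%E.

(* [gram x] is the Gram matrix of the inner product of T_x M. By
   [mdist_geodesic] the distance of M is the Riemannian one (C^1 curves and
   piecewise C^1 curves give the same infimum); as it is finite, M is
   connected. *)
Record riemannian_metric (R : realType) n (M : metricType R)
    (S : smooth_structure n M) := RiemannianMetric {
  gram : M -> 'M[R]_n;
  gram_sym : forall x, (gram x)^T = gram x;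
  gram_posdef : forall x (v : 'rV[R]_n), v != 0 -> 0 < bilin (gram x) v v;
  gram_smooth : forall c, atlas S c -> forall i j,
    smooth_on (codom c)
      (fun y => bilin (gram (bwd c y)) (chart_frame S c (bwd c y) i)
                                       (chart_frame S c (bwd c y) j));
  mdist_geodesic : forall x y : M,
    (mdist x y)%:E = ereal_inf [set curve_length S gram gamma | gamma in
      [set gamma | [/\ C1_curve S gamma, gamma 0 = x & gamma 1 = y]]]
}.

Section Riemannian.
Context (R : realType) (n : nat) (M : metricType R).
Context (S : smooth_structure n M) (g : riemannian_metric S).

Definition inner (x : M) (v w : 'rV[R]_n) : R := bilin (gram g x) v w.

(* |G|^(-1/2) \sum_i d_i (|G|^(1/2) \sum_j G^ij d_j f) in the chart at x *)
Definition laplacian (f : M -> R) (x : M) : R :=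
  let c := chart_at S x in
  let G y := \matrix_(i, j) inner (bwd c y) (chart_frame S c (bwd c y) i)
                                            (chart_frame S c (bwd c y) j) in
  let rho y := Num.sqrt (\det (G y)) in
  (\sum_i 'D_(delta_mx 0 i) (fun y => rho y *
     \sum_j invmx (G y) i j * 'D_(delta_mx 0 j) (f \o bwd c) y) (fwd c x))
  / rho (fwd c x).

(* the sigma-algebra generated by X_r, 0 <= r <= s *)
Definition past (Omega : Type) (X : R -> Omega -> M) (s : R) :
    set (set Omega) :=
  <<s [set A | exists r (U : set M),
         [/\ 0 <= r <= s, open U & A = X r @^-1` U]] >>.

(* Brownian motion with infinite life time, as a solution of the martingale
   problem for half the Laplacian *)
Definition brownian_motion d (Omega : measurableType d) (P : probability Omega R)
    (x : M) (X : R -> Omega -> M) : Prop :=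
  [/\ forall t (U : set M), 0 <= t -> open U -> measurable (X t @^-1` U),
      forall w, {within `[0, +oo[, continuous (X ^~ w)},
      forall w, X 0 w = x &
      forall f, smooth_fun S f -> compactly_supported f ->
      forall s t A, 0 <= s -> s <= t -> past X s A ->
        \int[P]_(w in A) (f (X t w) - f (X s w)
          - 2^-1 * \int[lebesgue_measure]_(r in `[s, t]) laplacian f (X r w))
        = 0].

Definition stochastically_complete : Prop :=
  forall x, exists (d : measure_display) (Omega : measurableType d)
    (P : probability Omega R) (X : R -> Omega -> M), brownian_motion P x X.

Record skew_connection := SkewConnection {
  nabla : (M -> 'rV[R]_n) -> (M -> 'rV[R]_n) -> M -> 'rV[R]_n;
  nabla_smooth : forall X Y, smooth_vf S X -> smooth_vf S Y ->
    smooth_vf S (nabla X Y);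
  nablaDl : forall X X' Y, smooth_vf S X -> smooth_vf S X' -> smooth_vf S Y ->
    forall x, nabla (fun y => X y + X' y) Y x = nabla X Y x + nabla X' Y x;
  nablaDr : forall X Y Y', smooth_vf S X -> smooth_vf S Y -> smooth_vf S Y' ->
    forall x, nabla X (fun y => Y y + Y' y) x = nabla X Y x + nabla X Y' x;
  nablaZl : forall f X Y, smooth_fun S f -> smooth_vf S X -> smooth_vf S Y ->
    forall x, nabla (fun y => f y *: X y) Y x = f x *: nabla X Y x;
  nablaZr : forall f X Y, smooth_fun S f -> smooth_vf S X -> smooth_vf S Y ->
    forall x, nabla X (fun y => f y *: Y y) x =
      f x *: nabla X Y x + dfun S f x (X x) *: Y x;
  nabla_metric : forall X Y Z,
    smooth_vf S X -> smooth_vf S Y -> smooth_vf S Z ->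
    forall x, dfun S (fun y => inner y (Y y) (Z y)) x (X x) =
      inner x (nabla X Y x) (Z x) + inner x (Y x) (nabla X Z x);
  torsion_skew : forall X Y Z,
    smooth_vf S X -> smooth_vf S Y -> smooth_vf S Z ->
    let torsion X Y x := nabla X Y x - nabla Y X x - lie S X Y x in
    forall x, inner x (torsion X Y x) (Z x) = - inner x (Y x) (torsion X Z x)
}.

End Riemannian.

(* A path [0, T] -> M is represented by its extension to R that is constant on
   ]-oo, 0] and on [T, +oo[. *)
Record path_from (R : realType) (T : R) (M : metricType R) (x0 : M) := PathFrom {
  path_fun :> R -> M;
  path_continuous : continuous path_fun;
  path_before : forall s, s <= 0 -> path_fun s = x0;
  path_after : forall s, T <= s -> path_fun s = path_fun T
}.

Section PathSpace.
Context (R : realType) (T : R) (M : metricType R) (x0 : M).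

HB.instance Definition _ := gen_eqMixin (path_from T x0).
HB.instance Definition _ := gen_choiceMixin (path_from T x0).

Definition constant_path : path_from T x0.
Proof. by exists (fun=> x0) => // s; exact: cvg_cst. Defined.

HB.instance Definition _ := isPointed.Build (path_from T x0) constant_path.

Definition uniform_dist (sigma tau : path_from T x0) : \bar R :=
  ereal_sup [set (mdist (sigma s) (tau s))%:E | s in `[0, T]].

Definition uniform_open : set (set (path_from T x0)) :=
  [set A | forall sigma, A sigma -> exists2 e : R, 0 < e &
     forall tau, (uniform_dist sigma tau < e%:E)%E -> A tau].

(* [path_from T x0] with its Borel sigma-algebra *)
Definition path_space := g_sigma_algebraType uniform_open.

HB.instance Definition _ := Measurable.on path_space.

Definition eval_at (s : R) (sigma : path_space) : M :=
  (sigma : path_from T x0) s.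

End PathSpace.

Section Stratonovich.
Context (R : realType) d (Omega : measurableType d) (P : probability Omega R).

(* int_0^s A o dB, as the limit in probability of the trapezoidal sums as the
   mesh of the partition t_0 <= ... <= t_N of [0, s] tends to 0 *)
Definition stratonovich_integral (A B : R -> Omega -> R) (s : R)
    (I : Omega -> R) : Prop :=
  measurable_fun setT I /\
  forall e : R, 0 < e -> exists2 delta : R, 0 < delta &
  forall (N : nat) (t : nat -> R), t 0%N = 0 -> t N = s ->
    (forall i, (i < N)%N -> 0 <= t i.+1 - t i < delta) ->
    (P [set w | e <= `| \sum_(i < N) (A (t i) w + A (t i.+1) w) / 2
                          * (B (t i.+1) w - B (t i) w) - I w |]%R <= e%:E)%E.

End Stratonovich.

Section ParallelTranslation.
Context (R : realType) (n : nat) (M : metricType R).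
Context (S : smooth_structure n M) (g : riemannian_metric S).
Context (D : skew_connection g) (T : R) (x0 : M).
Variable mu : probability (path_space T x0) R.

(* [par sigma s] is the matrix of //_s : T_x0 M -> T_(sigma s) M, acting on row
   vectors on the right. *)
Variable par : path_space T x0 -> R -> 'M[R]_n.

Definition transport s v (sigma : path_space T x0) : 'rV[R]_n :=
  v *m par sigma s.

(* i-th component of //_s v in the chart c, 0 outside the chart *)
Definition transport_coord c i s v (sigma : path_space T x0) : R :=
  if `[< dom c (eval_at s sigma) >]
  then chart_coord S c (eval_at s sigma) (transport s v sigma) 0 i else 0.

Definition transport_measurable : Prop :=
  forall c, atlas S c -> forall i s v, 0 <= s <= T ->
    measurable_fun setT (transport_coord c i s v).

(* the adaptedness is with respect to the mu-completed filtration *)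
Definition transport_adapted : Prop :=
  forall c, atlas S c -> forall i s v, 0 <= s <= T ->
    exists2 h : path_space T x0 -> R,
      (forall B : set R, measurable B -> past (@eval_at _ T _ x0) s (h @^-1` B)) &
      {ae mu, forall sigma, transport_coord c i s v sigma = h sigma}.

Definition transport_continuous (sigma : path_space T x0) : Prop :=
  forall f v, smooth_fun S f ->
    {within `[0, T],
      continuous (fun s => dfun S f (eval_at s sigma) (transport s v sigma))}.

Definition transport_isometric (sigma : path_space T x0) : Prop :=
  forall s v w, 0 <= s <= T ->
    inner g (eval_at s sigma) (transport s v sigma) (transport s w sigma)
    = inner g x0 v w.

(* The Stratonovich equation of parallel translation, tested against a smooth
   vector field Y. As D is metric, D o(//_s v) = 0 reads
     d <Y(sigma_s), //_s v> = < D_(o d sigma_s) Y, //_s v >,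
   and if D_X Y = \sum_j (X f_j) Y_j for all X, the right-hand side is
     \sum_j <Y_j(sigma_s), //_s v> o d(f_j(sigma_s)). *)
Definition transport_equation : Prop :=
  forall (Y : M -> 'rV[R]_n) (N : nat)
    (f : 'I_N -> M -> R) (Z : 'I_N -> M -> 'rV[R]_n),
    smooth_vf S Y ->
    (forall j, smooth_fun S (f j)) -> (forall j, smooth_vf S (Z j)) ->
    (forall X, smooth_vf S X -> forall x,
       nabla D X Y x = \sum_j dfun S (f j) x (X x) *: Z j x) ->
  forall s v, 0 <= s <= T ->
  exists2 I : 'I_N -> path_space T x0 -> R,
    (forall j, stratonovich_integral mu
       (fun r sigma => inner g (eval_at r sigma) (Z j (eval_at r sigma))
                                                 (transport r v sigma))
       (fun r sigma => f j (eval_at r sigma)) s (I j)) &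
    {ae mu, forall sigma,
       inner g (eval_at s sigma) (Y (eval_at s sigma)) (transport s v sigma)
       = inner g x0 (Y x0) v + \sum_j I j sigma}.

Definition parallel_translation : Prop :=
  [/\ transport_measurable, transport_adapted,
      {ae mu, forall sigma, par sigma 0 = 1%:M /\
                transport_continuous sigma /\ transport_isometric sigma} &
      transport_equation].

Definition fixed_end_point : Prop :=
  exists y, {ae mu, forall sigma, eval_at T sigma = y}.

(* A path k in the Cameron-Martin space is represented by its derivative phi;
   [cm_path phi] is k. *)
Definition cm_path (phi : R -> 'rV[R]_n) (s : R) : 'rV[R]_n :=
  \row_i \int[lebesgue_measure]_(r in `[0, s]) phi r 0 i.

(* int_0^T |phi_s|^2 ds: the squared norm of // k in H_sigma *)
Definition cm_norm2 (phi : R -> 'rV[R]_n) : \bar R :=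
  (\int[lebesgue_measure]_(s in `[0%R, T]) (inner g x0 (phi s) (phi s))%:E)%E.

Definition cm_inner (phi psi : R -> 'rV[R]_n) : R :=
  \int[lebesgue_measure]_(s in `[0, T]) inner g x0 (phi s) (psi s).

Definition cameron_martin (phi : R -> 'rV[R]_n) : Prop :=
  [/\ forall i, measurable_fun `[0, T] (fun s => phi s 0 i),
      (cm_norm2 phi < +oo)%E &
      fixed_end_point -> cm_path phi T = 0].

(* the element (//_s k_s)_s of H_sigma, with k = cm_path phi *)
Definition bismut_vector (sigma : path_space T x0) (phi : R -> 'rV[R]_n)
    (s : R) : 'rV[R]_n := transport s (cm_path phi s) sigma.

Record cylinder := Cylinder {
  cyl_size : nat;
  cyl_fun : {ptws 'I_cyl_size.+1 -> M} -> R;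
  cyl_time : 'I_cyl_size.+1 -> R;
  cyl_smooth : smooth_prod S cyl_fun;
  cyl_compact : compact (closure [set p | cyl_fun p != 0]);
  cyl_time_itv : forall i, 0 < cyl_time i < T;
  cyl_time_incr : forall i j : 'I_cyl_size.+1,
    (i < j)%N -> cyl_time i < cyl_time j
}.

Definition cyl_eval (F : cylinder) (sigma : path_space T x0) : R :=
  @cyl_fun F (fun i => eval_at (cyl_time i) sigma).

Definition cyl_diff (F : cylinder) (sigma : path_space T x0)
    (h : R -> 'rV[R]_n) : R :=
  \sum_i dfun S
    (fun y => @cyl_fun F
       (fun j => if j == i then y else eval_at (cyl_time j) sigma))
    (eval_at (cyl_time i) sigma) (h (cyl_time i)).

Definition is_gradient_at (F : cylinder) (sigma : path_space T x0)
    (phi : R -> 'rV[R]_n) : Prop :=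
  cameron_martin phi /\
  forall psi, cameron_martin psi ->
    cm_inner phi psi = cyl_diff F sigma (bismut_vector sigma psi).

(* A section sigma |-> // k(sigma) of the H_sigma is represented by the
   derivatives of the k(sigma), jointly measurable in (sigma, s). *)
Definition measurable_section (G : path_space T x0 -> R -> 'rV[R]_n) : Prop :=
  forall i, measurable_fun (setT `*` `[0, T])
    (fun p : path_space T x0 * measurableTypeR R => G p.1 p.2 0 i).

Definition cyl_gradient (F : cylinder)
    (G : path_space T x0 -> R -> 'rV[R]_n) : Prop :=
  measurable_section G /\
  {ae mu, forall sigma, is_gradient_at F sigma (G sigma)}.

(* f belongs to D^{1,2} and G represents its gradient: (f, G) is a limit in
   L^2(mu) x L^2(mu; H) of smooth cylindrical functions and their gradients *)
Definition sobolev_gradient (f : path_space T x0 -> R)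
    (G : path_space T x0 -> R -> 'rV[R]_n) : Prop :=
  [/\ measurable_fun setT f,
      (\int[mu]_sigma ((f sigma) ^+ 2)%:E < +oo)%E,
      measurable_section G &
      exists (F : nat -> cylinder)
        (GF : nat -> path_space T x0 -> R -> 'rV[R]_n),
      [/\ forall m, cyl_gradient (F m) (GF m),
          (fun m => \int[mu]_sigma
             ((f sigma - cyl_eval (F m) sigma) ^+ 2)%:E)%E @ \oo --> 0%E &
          (fun m => \int[mu]_sigma
             cm_norm2 (fun s => G sigma s - GF m sigma s)%R)%E
            @ \oo --> 0%E]].

(* the closure of the graph of the gradient is still a graph *)
Definition gradient_closable : Prop :=
  forall f G G', sobolev_gradient f G -> sobolev_gradient f G' ->
    {ae mu, forall sigma, cm_norm2 (fun s => G sigma s - G' sigma s) = 0%E}.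

End ParallelTranslation.

(* E (f log (f / E f)); here ln 0 = 0 and x / 0 = 0, so that 0 log 0 = 0 and
   Ent 0 = 0 *)
Definition entropy (R : realType) d (Omega : measurableType d)
    (P : probability Omega R) (f : Omega -> R) : \bar R :=
  (\int[P]_w (f w * ln (f w / \int[P]_w' f w'))%:E)%E.

(* Main.v *)
Require Import Defs.
From HB Require Import structures.
From mathcomp Require Import all_boot all_order all_algebra.
From mathcomp Require Import all_classical all_reals all_analysis.
From mathcomp Require Import measurable_realfun ess_sup_inf ring lra.

Set Implicit Arguments.
Unset Strict Implicit.
Unset Printing Implicit Defensive.

Import Order.TTheory GRing.Theory Num.Theory.
Import numFieldNormedType.Exports.

Local Open Scope classical_set_scope.
Local Open Scope ring_scope.

(** The weight [u ^+ 2] is unbounded, so the given inequality is applied not to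
    [f] but to [v = f * theta(u)], where [theta(u)] is close to 1 while [u ^+ 2]
    lies between a small [e] and a large [m], and decays on both sides.  Write
    [w = e / (e + u ^+ 2)] and [z = (u ^+ 2 / m) ^+ K]; then
    [theta(u) = (1 - w) / (1 + z)], and

    - [u ^+ 2 * theta(u) ^+ 2 <= m], so the part of the gradient of [v] that
      carries the gradient of [f] costs at most a multiple of
      [m * int |grad f| ^+ 2];
    - [(u * theta'(u)) ^+ 2 <= 8 w + 8 K ^+ 2 z], so, the gradient of [u] being
      bounded by [a], the other part costs a multiple of
      [|f|_oo ^+ 2 * a ^+ 2 * int (w + K ^+ 2 z)];
    - the mass [int (f ^+ 2 - v ^+ 2)] lost by cutting off is at most a
      multiple of [|f|_oo ^+ 2 * int (w + z)], and by convexity of [x ln x]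
      cutting off costs at most twice the square root of
      [|f|_oo ^+ 2 * int (f ^+ 2 - v ^+ 2)] in entropy ([entropy_le]).

    With [m = 8 K / C], the bound [t ^+ K / K! <= exp t] and the exponential
    moment of [u ^+ 2] give [int z <= B / 8 ^+ K]; [int w] is as small as wanted
    for small [e] because [u > 0] almost surely.  All errors are then of order
    [2 ^- K] while the energy is multiplied by [16 K / C]
    ([entropy_le_energy]); [K] of the order of [|ln s|] proves the theorem.

    The cutoff near 0 looks superfluous, since the weight is small there.  It
    is what makes [v] an element of the Sobolev space.  Two cylinder functions
    [F] and [G] depend in general on different times.  If [M] is not compact,
    the support of [F * h(G)] in the product of all the copies of [M] is then
    compact only when [h] vanishes at 0; and a sum of two cylinder functions is
    in general not one, so the factor cannot be split into a constant and a
    function vanishing at 0.  The cost of this cutoff is invisible because of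
    the weight: [u * theta'(u)] stays bounded as [e] tends to 0.

    For the membership of [v], cylinder functions [F] and [G] close to [f] and
    [u] are combined into the cylinder function [phi(F) * theta(G)]
    ([cylinder_mul]).  Here [phi x = x / (1 + l * x ^+ 2)] keeps the factor
    bounded, as the convergence of the gradients requires, and it differs
    little from [x] for small [l].  Both [phi] and [theta] are rational
    functions without poles, hence smooth.  The convergence
    ([sobolev_gradient_mul]) is a matter of dominated convergence along a
    subsequence that converges almost surely; it uses that the gradients of
    [f] and [u] are square integrable, which may be assumed for [f] because
    otherwise the claim is trivial. *)

(** * Functions of class C^k of matrix coordinates *)

Section CkTheory.
Context (R : realType) (m n : nat).
Implicit Types (f g : 'M[R]_(m, n) -> R) (U : set 'M[R]_(m, n)).

Lemma CkW k U f : Ck k.+1 U f -> Ck k U f.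
Proof.
elim: k f => [|k IH] f [fc fd]; first by split.
by split=> // i j; have [fij /IH] := fd i j.
Qed.

Lemma eq_Ck k U f g : open U -> (forall x, U x -> f x = g x) ->
  Ck k U f -> Ck k U g.
Proof.
move=> oU; elim: k f g => [|k IH] f g fg [fc fd];
  have nfg x : U x -> \near x, f x = g x
    by move=> Ux; near=> y; apply: fg; near: y; exact: open_nbhs_nbhs.
  have gc x : U x -> {for x, continuous g}.
    move=> Ux; rewrite /prop_for /continuous_at -(fg _ Ux).
    by apply: cvg_trans (near_eq_cvg (nfg x Ux)) (fc x Ux).
  by split.
have gc x : U x -> {for x, continuous g}.
  move=> Ux; rewrite /prop_for /continuous_at -(fg _ Ux).
  by apply: cvg_trans (near_eq_cvg (nfg x Ux)) (fc x Ux).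
split=> // i j.
have [fij Dfij] := fd i j; split=> [x Ux|].
  exact: near_eq_derivable (nfg x Ux) (fij x Ux).
apply: IH Dfij => x Ux.
exact: near_eq_derive (nfg x Ux).
Unshelve. all: by end_near. Qed.

Lemma Ck_cst k U (c : R) : Ck k U (fun=> c).
Proof.
elim: k c => [|k IH] c; split=> //; do ?by move=> x _; exact: cst_continuous.
move=> i j; split=> [x _|]; first exact: derivable_cst.
have -> : (fun x => 'D_(delta_mx i j) (fun=> c) x) = (fun=> 0 : R).
  by apply/funext => x; rewrite derive_cst.
exact: IH.
Qed.

Lemma CkD k U f g : open U -> Ck k U f -> Ck k U g ->
  Ck k U (fun x => f x + g x).
Proof.
move=> oU; elim: k f g => [|k IH] f g [fc fd] [gc gd].
  by split=> // x Ux; exact: cvgD (fc x Ux) (gc x Ux).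
split=> [x Ux|i j]; first exact: cvgD (fc x Ux) (gc x Ux).
have [fij Df] := fd i j; have [gij Dg] := gd i j.
split=> [x Ux|]; first by apply: derivableD; [exact: fij|exact: gij].
apply: eq_Ck oU _ (IH _ _ Df Dg) => x Ux.
by rewrite -deriveD //; [exact: fij|exact: gij].
Qed.

Lemma CkM k U f g : open U -> Ck k U f -> Ck k U g ->
  Ck k U (fun x => f x * g x).
Proof.
move=> oU; elim: k f g => [|k IH] f g /[dup] Cf [fc fd] /[dup] Cg [gc gd].
  by split=> // x Ux; exact: cvgM (fc x Ux) (gc x Ux).
split=> [x Ux|i j]; first exact: cvgM (fc x Ux) (gc x Ux).
have [fij Df] := fd i j; have [gij Dg] := gd i j.
split=> [x Ux|]; first by apply: derivableM; [exact: fij|exact: gij].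
apply: eq_Ck oU _ (CkD oU (IH _ _ (CkW Cf) Dg) (IH _ _ (CkW Cg) Df)) => x Ux.
by rewrite [RHS]deriveM //; [exact: fij|exact: gij].
Qed.

Lemma CkV k U f : open U -> (forall x, U x -> f x != 0) -> Ck k U f ->
  Ck k U (fun x => (f x)^-1).
Proof.
move=> oU f0; elim: k => [|k IH] /[dup] Cf [fc fd].
  by split=> // x Ux; exact: cvgV (f0 x Ux) (fc x Ux).
split=> [x Ux|i j]; first exact: cvgV (f0 x Ux) (fc x Ux).
have [fij Df] := fd i j.
split=> [x Ux|]; first by apply: derivableV; [exact: f0|exact: fij].
have CV := IH (CkW Cf).
apply: eq_Ck oU _ (CkM oU (Ck_cst k U (-1)) (CkM oU (CkM oU CV CV) Df)).
move=> x Ux; rewrite deriveV; [|exact: f0|exact: fij].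
by rewrite /GRing.scale/= mulN1r mulNr expr2 invfM.
Qed.

Let line_quotient f x v t : (fun h : R => h^-1 *:
    ((f \o shift (t *: v + x)) (h *: v) - f (t *: v + x))) =
  (fun h : R => h^-1 *: (((fun h : R => f (h *: v + x)) \o shift t) (h *: 1)
     - f (t *: v + x))).
Proof. by apply/funext => h /=; rewrite addrA -scalerDl [_%:A]mulr1. Qed.

Lemma derivable_line f x v t :
  derivable f (t *: v + x) v = derivable (fun h : R => f (h *: v + x)) t 1.
Proof. by rewrite /derivable line_quotient. Qed.

Lemma derive_line f x v t :
  'D_v f (t *: v + x) = 'D_1 (fun h : R => f (h *: v + x)) t.
Proof. by rewrite /derive line_quotient. Qed.

Lemma is_derive_line f x v t : derivable f (t *: v + x) v ->
  is_derive t 1 (fun h : R => f (h *: v + x)) ('D_v f (t *: v + x)).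
Proof. by rewrite derivable_line derive_line; exact: derivableP. Qed.

End CkTheory.

(** The mean value theorem on the segment from 0 to [h], whatever the sign of
    [h]. *)
Lemma MVT_center (R : realType) (f df : R -> R) (h : R) :
  (forall t : R, `|t| <= `|h| -> is_derive t 1 f (df t)) ->
  exists2 c, `|c| <= `|h| & f h - f 0 = df c * h.
Proof.
move=> fd.
have fc t : `|t| <= `|h| -> {for t, continuous f}.
  move=> /fd[dt _]; apply: differentiable_continuous.
  exact/derivable1_diffP.
have inc a b : `|a| <= `|h| -> `|b| <= `|h| ->
    {within `[a, b], continuous f}.
  move=> ah bh; apply: continuous_in_subspaceT => t.
  rewrite inE/= in_itv/= => /andP[at_ tb]; apply: fc.
  rewrite ler_norml; move: ah bh; rewrite !ler_norml.
  by move=> /andP[ah _] /andP[_ bh]; rewrite (le_trans ah)//= (le_trans tb).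
have [h0|h0] := leP 0 h.
  have [||c] := @MVT_segment _ f df 0 h h0.
  - move=> t; rewrite in_itv/= => /andP[t0 th]; apply: fd.
    by rewrite !ger0_norm// ltW.
  - by apply: inc; rewrite ?normr0.
  rewrite in_itv/= => /andP[c0 ch] ->; exists c; last by rewrite subr0.
  by rewrite !ger0_norm.
have [||c] := @MVT_segment _ f df h 0 (ltW h0).
- move=> t; rewrite in_itv/= => /andP[t0 th]; apply: fd.
  by rewrite !ltr0_norm// lerN2 ltW.
- by apply: inc; rewrite ?normr0.
rewrite in_itv/= => /andP[c0 ch] E; exists c.
  by rewrite ler0_norm// ltr0_norm// lerN2.
by rewrite -opprB E sub0r mulrN opprK.
Qed.

(** Derivatives of cylinder functions are taken in arbitrary directions, whereas
    [Ck] only speaks of the directions of the axes.  This section passes from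
    the latter to the former. *)
Section C1.
Context (R : realType) (m n : nat) (U : set 'M[R]_(m, n)).
Context (f : 'M[R]_(m, n) -> R).

Let C1dir v := forall x, U x ->
  derivable f x v /\ {for x, continuous (fun y => 'D_v f y)}.

(** The increment along [v + w] is the one along [v], followed by one along [w]
    that starts at a moving point; the mean value theorem and the continuity of
    the derivative along [w] control the latter. *)
Let C1dirD v w : open U -> C1dir v -> C1dir w -> C1dir (v + w).
Proof.
move=> oU fv fw.
have H x : U x -> (fun h : R => h^-1 *: ((f \o shift x) (h *: (v + w)) - f x))
    @ 0^' --> 'D_v f x + 'D_w f x.
  move=> Ux.
  have -> : (fun h : R => h^-1 *: ((f \o shift x) (h *: (v + w)) - f x)) =
    (fun h : R => h^-1 *: ((f \o shift x) (h *: v) - f x) +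
       h^-1 *: (f (h *: w + (h *: v + x)) - f (h *: v + x))).
    apply/funext => h /=; rewrite -scalerDr [X in _ = _ *: X]addrC subrKA.
    by rewrite (scalerDr h v w) (addrC (h *: v)) -addrA.
  apply: cvgD; first exact: (fv x Ux).1.
  apply/cvgrPdist_lt => e e0.
  have := (fw x Ux).2; move=> /cvgrPdist_lt /(_ e e0) nD.
  have : \forall y \near x, U y /\ `|'D_w f x - 'D_w f y| < e.
    by near=> y; split; near: y => //; exact: open_nbhs_nbhs.
  move=> /nbhs_ballP [d /= d0 Hd].
  near=> h.
  have h0 : h != 0 by near: h; exact: nbhs_dnbhs_neq.
  have vw : 0 < `|v| + `|w| + 1 by rewrite ltr_pwDr// addr_ge0.
  have hd : `|h| * (`|v| + `|w| + 1) < d.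
    rewrite -ltr_pdivlMr//.
    by near: h; apply: dnbhs0_lt; rewrite divr_gt0.
  have near_x t : `|t| <= `|h| -> ball x d (t *: w + (h *: v + x)).
    move=> th; rewrite -ball_normE /ball_ /=.
    have -> : x - (t *: w + (h *: v + x)) = - (t *: w + h *: v).
      by rewrite addrA opprD addrCA subrr addr0.
    rewrite normrN (le_lt_trans _ hd)// (le_trans (ler_normD _ _))//.
    rewrite !normrZ addrC !mulrDr mulr1 -addrA lerD2l.
    by rewrite ler_wpDr// ler_wpM2r.
  have [|c ch] := @MVT_center _ (fun t => f (t *: w + (h *: v + x)))
      (fun t => 'D_w f (t *: w + (h *: v + x))) h.
    move=> t /near_x /Hd[Ut _]; apply: is_derive_line.
    exact: (fw _ Ut).1.
  rewrite scale0r add0r => ->.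
  rewrite /GRing.scale/= mulrC mulfK//.
  by have [_] := Hd _ (near_x _ ch).
move=> x Ux; split; first by apply/cvg_ex; eexists; exact: H.
have E y : U y -> 'D_(v + w) f y = 'D_v f y + 'D_w f y.
  by move=> Uy; apply/cvg_lim => //; exact: H.
rewrite /prop_for /continuous_at E//.
have nE : \near x, ('D_v f + 'D_w f) x = 'D_(v + w) f x.
  by near=> y; rewrite E//; near: y; exact: open_nbhs_nbhs.
exact: cvg_trans (near_eq_cvg nE) (cvgD (fv x Ux).2 (fw x Ux).2).
Unshelve. all: by end_near. Qed.

Let C1dirZ (a : R) v : open U -> C1dir v -> C1dir (a *: v).
Proof.
move=> oU fv.
have H x : U x -> is_derive x (a *: v) f (a * 'D_v f x).
  move=> Ux; have [dfv _] := fv x Ux.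
  have := @is_derive_line _ _ _ f x v 0; rewrite scale0r add0r => /(_ dfv) d0.
  have d1 : is_derive (0 : R) 1 (fun h : R => h * a) a.
    by apply: is_derive_eq; rewrite [_%:A]mulr1 scaler0 add0r.
  have := @is_derive1_comp _ (fun h => f (h *: v + x)) (fun h => h * a) 0 _ _.
  rewrite mul0r => /(_ _ _ d0 d1).
  have -> : (fun h => f (h *: v + x)) \o (fun h => h * a) =
      (fun h => f (h *: (a *: v) + x)).
    by apply/funext => h /=; rewrite scalerA.
  move=> [D1 D2]; apply: DeriveDef.
    by have := derivable_line f x (a *: v) 0; rewrite scale0r add0r => ->.
  have := derive_line f x (a *: v) 0; rewrite scale0r add0r => ->.
  by rewrite D2 mulrC.
move=> x Ux; split; first by have [] := H x Ux.
have E y : U y -> 'D_(a *: v) f y = a * 'D_v f y.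
  by move=> /H[_ ->].
rewrite /prop_for /continuous_at E//.
have nE : \near x, (cst a \* 'D_v f) x = 'D_(a *: v) f x.
  by near=> y; rewrite E//; near: y; exact: open_nbhs_nbhs.
have ac : {for x, continuous (cst a : 'M[R]_(m, n) -> R)}.
  exact: cst_continuous.
have av := cvgM ac (fv x Ux).2.
exact: cvg_trans (near_eq_cvg nE) (av _).
Unshelve. all: by end_near. Qed.

Lemma Ck1_derivable x v : open U -> Ck 1 U f -> U x -> derivable f x v.
Proof.
move=> oU [_ fd] Ux; suff : C1dir v by move=> /(_ x Ux)[].
have C10 : C1dir 0.
  move=> y _; split; first exact: derivable0.
  have -> : (fun y => 'D_0 f y) = cst 0.
    by apply/funext => z; rewrite derive0.
  exact: cst_continuous.
rewrite (matrix_sum_delta v).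
apply: (@big_ind _ C1dir); [exact: C10|move=> *; exact: C1dirD|move=> i _].
apply: (@big_ind _ C1dir); [exact: C10|move=> *; exact: C1dirD|move=> j _].
apply: C1dirZ => [|y Uy]; first by [].
have [fij [Df _]] := fd i j.
by split; [exact: fij|exact: Df].
Qed.
End C1.

Lemma sub_Ck (R : realType) (m n k : nat) (U V : set 'M[R]_(m, n)) f :
  U `<=` V -> Ck k V f -> Ck k U f.
Proof.
move=> UV; elim: k f => [|k IH] f [fc fd]; first by split=> // x /UV; exact: fc.
split=> [x /UV|i j]; first exact: fc.
have [fij Df] := fd i j; split=> [x /UV|]; first exact: fij.
exact: IH.
Qed.

(** Closure of the class of smooth functions under composition with [h] is
    stated directly, so that it can be checked for a rational function from the
    stability of [Ck] under ring operations and inverses, without computing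
    any iterated derivative. *)
Definition smooth_stable (R : realType) (h : R -> R) : Prop :=
  forall m n (U : set 'M[R]_(m, n)) f, open U ->
    smooth_on U f -> smooth_on U (h \o f).

Section SmoothStable.
Context (R : realType).
Implicit Types h : R -> R.

Lemma smooth_stable_id : smooth_stable (fun x : R => x).
Proof. by []. Qed.

Lemma smooth_stable_cst (c : R) : smooth_stable (fun=> c).
Proof. by move=> m n U f oU sf k; exact: Ck_cst. Qed.

Lemma smooth_stableD h1 h2 : smooth_stable h1 -> smooth_stable h2 ->
  smooth_stable (fun x => h1 x + h2 x).
Proof.
move=> s1 s2 m n U f oU sf k.
exact: CkD oU (s1 _ _ _ _ oU sf k) (s2 _ _ _ _ oU sf k).
Qed.

Lemma smooth_stableM h1 h2 : smooth_stable h1 -> smooth_stable h2 ->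
  smooth_stable (fun x => h1 x * h2 x).
Proof.
move=> s1 s2 m n U f oU sf k.
exact: CkM oU (s1 _ _ _ _ oU sf k) (s2 _ _ _ _ oU sf k).
Qed.

Lemma smooth_stableV h : (forall x, h x != 0) -> smooth_stable h ->
  smooth_stable (fun x => (h x)^-1).
Proof.
move=> h0 s m n U f oU sf k.
exact: CkV oU (fun x _ => h0 (f x)) (s _ _ _ _ oU sf k).
Qed.

Lemma smooth_stableX j : smooth_stable (fun x : R => x ^+ j).
Proof.
elim: j => [|j IH]; first exact: smooth_stable_cst.
rewrite (_ : (fun x : R => _) = (fun x : R => x * x ^+ j)).
  exact: smooth_stableM smooth_stable_id IH.
by apply/funext => x; rewrite exprS.
Qed.

End SmoothStable.

(** * Smooth functions of several points of a manifold *)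

Section Rowsub.
Context (R : realType) (m p n : nat) (h : 'I_p -> 'I_m).

Lemma rowsub_continuous :
  continuous (fun y : 'M[R]_(m, n) => rowsub h y : 'M[R]_(p, n)).
Proof.
move=> y; apply/(@cvg_ballP R _ _ (nbhs y)) => e e0.
apply/nbhs_ballP; exists e => //= z [_ yz].
by split=> // i j; rewrite !mxE; exact: yz.
Qed.

Lemma rowsub_line (f : 'M[R]_(p, n) -> R) x v :
  (fun t : R => t^-1 *: (((f \o rowsub h) \o shift x) (t *: v)
                        - f (rowsub h x)))
  = (fun t : R => t^-1 *: ((f \o shift (rowsub h x)) (t *: rowsub h v)
                        - f (rowsub h x))).
Proof.
apply/funext => t /=; congr (_ *: (f _ - _)).
by apply/matrixP => i j; rewrite !mxE.
Qed.

Lemma rowsub_delta i j : injective h ->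
  rowsub h (delta_mx i j : 'M[R]_(m, n)) =
  if [pick i' | h i' == i] is Some i' then delta_mx i' j else 0.
Proof.
move=> hI; case: pickP => [i' /eqP <-|no]; apply/matrixP => a b; rewrite !mxE.
  by rewrite (inj_eq hI).
by rewrite no.
Qed.

(** A coordinate direction is mapped by [rowsub h] to a coordinate direction or
    to 0, because [h] is injective: partial derivatives remain partial
    derivatives. *)
Lemma Ck_rowsub k (U : set 'M[R]_(p, n)) f : injective h -> Ck k U f ->
  Ck k [set y | U (rowsub h y)] (f \o rowsub h).
Proof.
move=> hI; elim: k f => [|k IH] f [fc fd];
  have ch x : U (rowsub h x) -> {for x, continuous (f \o rowsub h)}
    by move=> Ux; apply: continuous_comp; [exact: rowsub_continuous|exact: fc].
  by split.
split=> // i j.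
have E v x : derivable (f \o rowsub h) x v =
    derivable f (rowsub h x) (rowsub h v).
  by rewrite /derivable rowsub_line.
have E' v x : 'D_v (f \o rowsub h) x = 'D_(rowsub h v) f (rowsub h x).
  by rewrite /derive rowsub_line.
have -> : 'D_(delta_mx i j) (f \o rowsub h) =
  (fun x => 'D_(rowsub h (delta_mx i j)) f x) \o rowsub h.
  by apply/funext => x; rewrite E'.
have := @rowsub_delta i j hI; case: pickP => [i' _|_] rd; rewrite rd.
  have [fij Df] := fd i' j; split; last exact: IH Df.
  by move=> x Ux; rewrite E rd; exact: fij.
split=> [x Ux|]; first by rewrite E rd; exact: derivable0.
have -> : ((fun x => 'D_0 f x) \o rowsub h) = (fun=> 0 : R).
  by apply/funext => x /=; rewrite derive0.
exact: Ck_cst.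
Qed.

End Rowsub.

Section SmoothProd.
Context (R : realType) (n : nat) (M : metricType R) (S : smooth_structure n M).

Definition prod_codom k (c : 'I_k -> chart n M) : set 'M[R]_(k, n) :=
  [set y | forall i, Defs.codom (c i) (row i y)].

Definition prod_bwd k (c : 'I_k -> chart n M) (y : 'M[R]_(k, n)) :
  {ptws 'I_k -> M} := fun i => bwd (c i) (row i y).

Definition prod_fwd k (c : 'I_k -> chart n M) (p : {ptws 'I_k -> M}) :
  'M[R]_(k, n) := \matrix_i fwd (c i) (p i).

Definition charts_at k (p : {ptws 'I_k -> M}) i := chart_at S (p i).

Lemma prod_fwdK k (p : {ptws 'I_k -> M}) :
  prod_bwd (charts_at p) (prod_fwd (charts_at p) p) = p.
Proof.
apply/funext => i; rewrite /prod_bwd /prod_fwd rowK fwdK//.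
exact: chart_at_dom.
Qed.

Lemma prod_codom_fwd k (p : {ptws 'I_k -> M}) :
  prod_codom (charts_at p) (prod_fwd (charts_at p) p).
Proof.
by move=> i; rewrite rowK; exists (p i) => //; exact: chart_at_dom.
Qed.

Lemma row_continuous k (i : 'I_k) :
  continuous (fun y : 'M[R]_(k, n) => row i y : 'rV[R]_n).
Proof.
move=> y; apply/(@cvg_ballP R _ _ (nbhs y)) => e e0; apply/nbhs_ballP.
exists e => //= z [_ yz].
by split=> // j j'; rewrite !mxE; exact: yz.
Qed.

Lemma open_prod_codom k (c : 'I_k -> chart n M) : open (prod_codom c).
Proof.
rewrite openE => y yc.
have : \forall z \near y, forall i, Defs.codom (c i) (row i z).
  apply: (@filter_forall _ _ (fun i z => Defs.codom (c i) (row i z))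
    (nbhs y) (nbhs_filter y)) => i.
  apply: (@row_continuous k i y (Defs.codom (c i))).
  apply: open_nbhs_nbhs; split => //.
  exact: codom_open.
exact.
Qed.

Arguments open_prod_codom [k] c.

Lemma smooth_prod_at k (F : {ptws 'I_k -> M} -> R) p :
  smooth_prod S F ->
  smooth_on (prod_codom (charts_at p)) (F \o prod_bwd (charts_at p)).
Proof. by apply => i; exact: chart_at_atlas. Qed.

(** A function of some of the points, seen as a function of all of them. *)
Lemma smooth_prod_reindex k l (h : 'I_k -> 'I_l) (F : {ptws 'I_k -> M} -> R) :
  injective h -> smooth_prod S F ->
  smooth_prod S (fun p : {ptws 'I_l -> M} => F (p \o h)).
Proof.
move=> hI sF c ac j.
have := Ck_rowsub hI (sF (c \o h) (fun i => ac (h i)) j).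
rewrite (_ : _ \o _ = (fun y : 'M[R]_(l, n) =>
    F ((fun i => bwd (c i) (row i y)) \o h))).
  apply: sub_Ck => y yc i /=.
  have -> : row i (rowsub h y) = row (h i) y.
    by apply/rowP => b; rewrite !mxE.
  exact: yc.
apply/funext => y /=; congr F; apply/funext => i /=.
by congr bwd; apply/rowP => b; rewrite !mxE.
Qed.

(** Continuity in the form that suits the uniform distance of paths. *)
Lemma smooth_prod_near k (F : {ptws 'I_k -> M} -> R) p (V : set R) :
  smooth_prod S F -> nbhs (F p) V ->
  exists2 e : R, 0 < e &
    forall q : {ptws 'I_k -> M}, (forall i, mdist (p i) (q i) < e) -> V (F q).
Proof.
move=> sF FpV; set c := charts_at p.
have [Fc _] := smooth_prod_at p sF 0%N.
have := Fc _ (prod_codom_fwd p); rewrite /prop_for /continuous_at/= prod_fwdK.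
move=> /(_ V FpV) /= [P nP PV].
have near_i i : \forall e \near 0^'+, forall x, mdist (p i) x < e ->
    Defs.dom (c i) x /\ forall j, P i j (fwd (c i) x 0 j).
  have : \forall x \near p i,
      Defs.dom (c i) x /\ forall j, P i j (fwd (c i) x 0 j).
    near=> x; split; first by near: x; apply: open_nbhs_nbhs; split;
      [exact: dom_open|exact: chart_at_dom].
    near: x; apply: (@filter_forall _ _ (fun j x => P i j (fwd (c i) x 0 j))
      (nbhs (p i)) (nbhs_filter (p i))) => j.
    have cp : {for p i, continuous (fwd (c i))}.
      by apply: fwd_continuous; exact: chart_at_dom.
    have cj : {for p i, continuous (fun x => fwd (c i) x 0 j)}.
      apply: (@continuous_comp _ _ _ (fwd (c i))
        (fun v : 'rV[R]_n => v 0 j)) => //.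
      exact: coord_continuous.
    by apply: cj; have := nP i j; rewrite mxE.
  move=> /metricType_numDomainType.nbhs_mdistP[e /= e0 He]; near=> e' => x px.
  by apply: He; rewrite /= (lt_trans px).
have [e [e0 He]] : exists e : R, 0 < e /\ forall i x, mdist (p i) x < e ->
    Defs.dom (c i) x /\ forall j, P i j (fwd (c i) x 0 j).
  have nall := @filter_forall _ _ _ _ (at_right_proper_filter 0) near_i.
  near (0 : R)^'+ => e.
  by exists e; split => //; near: e.
exists e => // q pq.
have := PV (prod_fwd c q); rewrite /= /prod_fwd /prod_bwd.
rewrite (_ : (fun i => _) = q).
  apply=> i j; rewrite !mxE.
  by have [_] := He i _ (pq i).
apply/funext => i; rewrite rowK fwdK//.
by have [] := He i _ (pq i).
Unshelve. all: by end_near. Qed.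

Lemma smooth_prod_mul k (F G : {ptws 'I_k -> M} -> R) :
  smooth_prod S F -> smooth_prod S G -> smooth_prod S (fun p => F p * G p).
Proof.
move=> sF sG c ac j.
exact: CkM (open_prod_codom c) (sF c ac j) (sG c ac j).
Qed.

(** The functions of one point whose derivatives make up the differential of a
    cylinder function. *)
Definition slice k (F : {ptws 'I_k -> M} -> R) (p : {ptws 'I_k -> M}) i y :=
  F (fun j => if j == i then y else p j).

Lemma slice_derivable k (F : {ptws 'I_k -> M} -> R) p i v : smooth_prod S F ->
  derivable (slice F p i \o bwd (chart_at S (p i)))
    (fwd (chart_at S (p i)) (p i)) v.
Proof.
move=> sF; set c := charts_at p.
pose V : 'M[R]_(k, n) := \matrix_j (if j == i then v else 0).
have := @Ck1_derivable _ _ _ _ _ (prod_fwd c p) V (open_prod_codom c)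
  (smooth_prod_at p sF 1%N) (@prod_codom_fwd _ p).
move=> /derivable1P df; apply/derivable1P.
rewrite (_ : (fun h : R => _) = (fun h : R =>
  (F \o prod_bwd (charts_at p)) (h *: V + prod_fwd c p)))//.
apply/funext => h /=; congr F; apply/funext => j; rewrite /prod_bwd.
rewrite linearD linearZ/= !rowK; case: eqP => [->//|_].
by rewrite scaler0 add0r fwdK//; apply: chart_at_dom.
Qed.

End SmoothProd.

Lemma derive_comp_mul (R : realType) (n : nat) (A B : 'rV[R]_n -> R)
    (phi theta phi' theta' : R -> R) x v :
  derivable A x v -> derivable B x v ->
  is_derive (A x) 1 phi (phi' (A x)) ->
  is_derive (B x) 1 theta (theta' (B x)) ->
  'D_v (fun y => phi (A y) * theta (B y)) x =
  phi' (A x) * theta (B x) * 'D_v A x + phi (A x) * theta' (B x) * 'D_v B x.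
Proof.
move=> dA dB dphi dtheta.
have lineA := @is_derive_line _ _ _ A x v 0.
have lineB := @is_derive_line _ _ _ B x v 0.
rewrite scale0r add0r in lineA lineB.
have {}lineA := lineA dA; have {}lineB := lineB dB.
have := derive_line (fun y => phi (A y) * theta (B y)) x v 0.
rewrite scale0r add0r => ->.
have A0 : A (0 *: v + x) = A x by rewrite scale0r add0r.
have B0 : B (0 *: v + x) = B x by rewrite scale0r add0r.
have dpA : is_derive (0 : R) 1 (phi \o (fun h : R => A (h *: v + x)))
    (phi' (A x) * 'D_v A x).
  by apply: is_derive1_comp; rewrite A0.
have dtB : is_derive (0 : R) 1 (theta \o (fun h : R => B (h *: v + x)))
    (theta' (B x) * 'D_v B x).
  by apply: is_derive1_comp; rewrite B0.
have [_ ] := is_deriveM dpA dtB.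
rewrite /= A0 B0 => ->.
by rewrite /GRing.scale/=; ring.
Qed.

Section DfunProd.
Context (R : realType) (n : nat) (M : metricType R) (S : smooth_structure n M).
Context (k : nat).
Implicit Types (F : {ptws 'I_k -> M} -> R) (p : {ptws 'I_k -> M}).

Lemma eq_dfun (f f' : M -> R) x v :
  (forall y, f y = f' y) -> dfun S f x v = dfun S f' x v.
Proof. by move=> ff'; have -> : f = f' by exact/funext. Qed.

Lemma dfun_slice_mul F G p i v (phi theta phi' theta' : R -> R) :
  smooth_prod S F -> smooth_prod S G ->
  is_derive (F p) 1 phi (phi' (F p)) ->
  is_derive (G p) 1 theta (theta' (G p)) ->
  dfun S (slice (fun q => phi (F q) * theta (G q)) p i) (p i) v =
  phi' (F p) * theta (G p) * dfun S (slice F p i) (p i) v +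
  phi (F p) * theta' (G p) * dfun S (slice G p i) (p i) v.
Proof.
move=> sF sG dphi dtheta.
have E (H : {ptws 'I_k -> M} -> R) :
    (slice H p i \o bwd (chart_at S (p i)))
      (fwd (chart_at S (p i)) (p i)) = H p.
  rewrite /= fwdK; last exact: chart_at_dom.
  by congr H; apply/funext => j; case: eqP => [->|].
rewrite /dfun.
have := @derive_comp_mul _ _ (slice F p i \o bwd (chart_at S (p i)))
  (slice G p i \o bwd (chart_at S (p i))) phi theta phi' theta'
  (fwd (chart_at S (p i)) (p i)) v.
rewrite !E; apply => //; exact: slice_derivable.
Qed.

(** Points outside the image of [h] contribute derivatives of constants. *)
Lemma sum_dfun_reindex l (h : 'I_k -> 'I_l) F (q : {ptws 'I_l -> M})
    (w : 'I_l -> 'rV[R]_n) : injective h ->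
  \sum_i dfun S (slice (fun p : {ptws 'I_l -> M} => F (p \o h)) q i)
    (q i) (w i) =
  \sum_i dfun S (slice F (q \o h) i) (q (h i)) (w (h i)).
Proof.
move=> hI; rewrite [RHS](partition_big h predT)//=; apply: eq_bigr => i _.
case: (pickP (fun i' => h i' == i)) => [i' /eqP <-|no].
  rewrite (big_pred1 i') => [|j /=]; last by rewrite (inj_eq hI).
  apply: eq_dfun => y; congr F; apply/funext => j /=.
  by rewrite (inj_eq hI).
rewrite big_pred0//.
have -> : slice (fun p : {ptws 'I_l -> M} => F (p \o h)) q i = cst (F (q \o h)).
  by apply/funext => y; congr F; apply/funext => j /=; rewrite no.
exact: derive_cst.
Qed.

End DfunProd.

(** * Products of cylinder functions *)

Section MergeTimes.
Context (R : realType).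

(** Two cylinder functions depend on their points at different times; their
    product is a cylinder function for the ordered union of these times. *)
Lemma merge_times k l (t : 'I_k.+1 -> R) (r : 'I_l -> R) :
  exists N (s : 'I_N.+1 -> R) (ht : 'I_k.+1 -> 'I_N.+1) (hr : 'I_l -> 'I_N.+1),
  [/\ forall i j : 'I_N.+1, (i < j)%N -> s i < s j,
      forall i, s (ht i) = t i, forall j, s (hr j) = r j &
      forall i, (exists i', ht i' = i) \/ (exists j', hr j' = i)].
Proof.
pose w := sort <=%R (undup (codom t ++ codom r)).
have mw x : (x \in w) = (x \in codom t) || (x \in codom r).
  by rewrite mem_sort mem_undup mem_cat.
have sw : sorted <%R w by rewrite sort_lt_sorted undup_uniq.
have tw i : t i \in w by rewrite mw codom_f.
have rw j : r j \in w by rewrite mw codom_f orbT.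
case: (posnP (size w)) => [w0|].
  by move: (tw ord0); rewrite (size0nil w0).
case E : (size w) => [//|N] _.
have iw x : x \in w -> exists i : 'I_N.+1, nth 0 w i = x.
  rewrite -index_mem E => xw; exists (Ordinal xw) => /=.
  by rewrite nth_index// -index_mem E.
exists N, (fun i => nth 0 w i).
have [ht htE] := choice (fun i => iw _ (tw i)).
have [hr hrE] := choice (fun i => iw _ (rw i)).
exists ht, hr; split=> //.
  move=> i j ij; rewrite (lt_sorted_ltn_nth 0 sw)// inE E//.
have inj (i j : 'I_N.+1) : nth 0 w i = nth 0 w j -> i = j.
  move=> /eqP; rewrite nth_uniq ?E// ?(lt_sorted_uniq sw)// => /eqP ij.
  exact: val_inj.
move=> i; have : nth 0 w i \in w by rewrite mem_nth// E.
rewrite mw => /orP[/codomP[i' e]|/codomP[j' e]].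
  by left; exists i'; apply: inj; rewrite htE.
by right; exists j'; apply: inj; rewrite hrE.
Qed.

End MergeTimes.

(** Every coordinate of a point of [C] is a coordinate of a point of [A] or of
    [B], hence lies in a fixed compact set; Tychonoff's theorem concludes. *)
Lemma compact_support_merge (M : topologicalType) k l N
    (hk : 'I_k -> 'I_N) (hl : 'I_l -> 'I_N)
    (A : set {ptws 'I_k -> M}) (B : set {ptws 'I_l -> M})
    (C : set {ptws 'I_N -> M}) :
  hausdorff_space M ->
  (forall i, (exists i', hk i' = i) \/ (exists j', hl j' = i)) ->
  compact (closure A) -> compact (closure B) ->
  (forall p, C p -> A (p \o hk) /\ B (p \o hl)) -> compact (closure C).
Proof.
move=> hM cov cA cB CAB.
have proj_compact m (X : set {ptws 'I_m -> M}) i :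
    compact (closure X) ->
    compact ((fun p : {ptws 'I_m -> M} => p i) @` closure X).
  move=> cX; apply: continuous_compact => //.
  exact/continuous_subspaceT/proj_continuous.
have [K cK CK] : exists2 K : 'I_N -> set M, (forall i, compact (K i)) &
    (forall p, C p -> forall i, K i (p i)).
  have : forall i, exists Ki : set M, compact Ki /\ forall p, C p -> Ki (p i).
    move=> i; have [[i' <-]|[j' <-]] := cov i; eexists; split.
    - exact: (proj_compact _ _ i' cA).
    - by move=> p /CAB[Ap _]; exists (p \o hk) => //; exact: subset_closure.
    - exact: (proj_compact _ _ j' cB).
    - by move=> p /CAB[_ Bp]; exists (p \o hl) => //; exact: subset_closure.
  move=> /choice[K KP]; exists K => [i|p Cp i]; have [cKi KC] := KP i => //.
  exact: KC.
pose P : set {ptws 'I_N -> M} := [set p | forall i, K i (p i)].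
have cP : compact P by exact: tychonoff.
have clP : closed P.
  by apply: compact_closed => //; exact: hausdorff_product.
apply: subclosed_compact cP _; first exact: closed_closure.
move=> p; move/closure_subset/(_ p) : (CK : C `<=` P).
by rewrite -(closure_id P).1.
Qed.

(** [phi] vanishes at 0 so that composing a cylinder function with it does not
    enlarge the support; the bounds make the products of such compositions and
    of their gradients converge. *)
Record test_function (R : realType) (phi phi' : R -> R) : Prop := TestFunction {
  test_smooth : smooth_stable phi;
  test0 : phi 0 = 0;
  test_derive : forall x : R, is_derive x 1 phi (phi' x);
  test_derive_continuous : continuous phi';
  test_bounded : exists2 b : R, 0 < b &
    forall x, `|phi x| <= b /\ `|phi' x| <= b
}.

Section Cylinders.
Context (R : realType) (n : nat) (M : metricType R) (S : smooth_structure n M).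
Context (T : R) (x0 : M).
Implicit Types (F G H : cylinder S T).

(** The support of the product is compact in the product of all the copies of
    [M] because both factors vanish where [F], respectively [G], does. *)
Lemma cylinder_mul (phi theta phi' theta' : R -> R) F G :
  test_function phi phi' -> test_function theta theta' ->
  exists H,
    (forall sigma : path_space T x0, cyl_eval H sigma =
       phi (cyl_eval F sigma) * theta (cyl_eval G sigma)) /\
    (forall (sigma : path_space T x0) w, cyl_diff H sigma w =
       phi' (cyl_eval F sigma) * theta (cyl_eval G sigma) * cyl_diff F sigma w +
       phi (cyl_eval F sigma) * theta' (cyl_eval G sigma) * cyl_diff G sigma w).
Proof.
move=> tphi ttheta.
have [N [s [hF [hG [s_incr sF sG cov]]]]] :=
  merge_times (@cyl_time _ _ _ _ _ F) (@cyl_time _ _ _ _ _ G).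
have time_inj H : injective (@cyl_time _ _ _ _ _ H).
  move=> i j ij; apply: val_inj.
  by case: (ltngtP i j) => // /cyl_time_incr; rewrite ij ltxx.
have hFI : injective hF.
  by move=> i j ij; apply: (time_inj F); rewrite -!sF ij.
have hGI : injective hG.
  by move=> i j ij; apply: (time_inj G); rewrite -!sG ij.
have sT i : 0 < s i < T.
  by have [[i' <-]|[j' <-]] := cov i; rewrite ?sF ?sG; exact: cyl_time_itv.
pose F' (p : {ptws 'I_N.+1 -> M}) := @cyl_fun _ _ _ _ _ F (p \o hF).
pose G' (p : {ptws 'I_N.+1 -> M}) := @cyl_fun _ _ _ _ _ G (p \o hG).
have smF : smooth_prod S F' :=
  smooth_prod_reindex hFI (@cyl_smooth _ _ _ _ _ F).
have smG : smooth_prod S G' :=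
  smooth_prod_reindex hGI (@cyl_smooth _ _ _ _ _ G).
pose H' p := phi (F' p) * theta (G' p).
have smH : smooth_prod S H'.
  apply: smooth_prod_mul => c ac.
    by apply: (test_smooth tphi); [exact: open_prod_codom|exact: smF].
  by apply: (test_smooth ttheta); [exact: open_prod_codom|exact: smG].
have cH : compact (closure [set p | H' p != 0]).
  apply: compact_support_merge cov (@cyl_compact _ _ _ _ _ F)
    (@cyl_compact _ _ _ _ _ G) _; first exact: metric_hausdorff.
  move=> p; rewrite /= /H' mulf_eq0 negb_or => /andP[pF pG]; split.
    by apply: contraNneq pF => F0; rewrite /F' F0 (test0 tphi).
  by apply: contraNneq pG => G0; rewrite /G' G0 (test0 ttheta).
exists (Cylinder smH cH sT s_incr).
pose pt (sigma : path_space T x0) : {ptws 'I_N.+1 -> M} :=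
  fun i => eval_at (s i) sigma.
have FE sigma : F' (pt sigma) = cyl_eval F sigma.
  by congr cyl_fun; apply/funext => i; rewrite /pt/= sF.
have GE sigma : G' (pt sigma) = cyl_eval G sigma.
  by congr cyl_fun; apply/funext => i; rewrite /pt/= sG.
split=> [sigma|sigma w]; first by rewrite -FE -GE.
have -> : cyl_diff (Cylinder smH cH sT s_incr) sigma w =
    \sum_i dfun S (slice H' (pt sigma) i) (pt sigma i) (w (s i)) by [].
under eq_bigr => i _.
  rewrite (dfun_slice_mul _ _ smF smG (test_derive tphi _)
    (test_derive ttheta _)).
  over.
rewrite big_split/= -!mulr_sumr FE GE; congr (_ * _ + _ * _).
  rewrite (sum_dfun_reindex S _ (pt sigma) (w \o s) hFI).
  apply: eq_bigr => i _; rewrite /pt /= sF; apply: eq_dfun => y.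
  by congr cyl_fun; apply/funext => j /=; rewrite sF.
rewrite (sum_dfun_reindex S _ (pt sigma) (w \o s) hGI).
apply: eq_bigr => i _; rewrite /pt /= sG; apply: eq_dfun => y.
by congr cyl_fun; apply/funext => j /=; rewrite sG.
Qed.

(** A cylinder function is continuous for the uniform distance, hence Borel. *)
Lemma cyl_eval_measurable F :
  measurable_fun setT (fun sigma : path_space T x0 => cyl_eval F sigma).
Proof.
apply: (measurability _ (measurable_realfun.RGenOpens.measurableE R)).
move=> _ [_ [a [b ->]] <-].
rewrite setTI; apply: sub_sigma_algebra.
move=> sigma; rewrite /= => Vs.
have nV : nbhs (cyl_eval F sigma) `]a, b[%classic.
  by apply: open_nbhs_nbhs; split => //; exact: itv_open.
have [e e0 He] := smooth_prod_near (@cyl_smooth _ _ _ _ _ F) nV.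
exists e => // tau st; apply: He => i.
rewrite -lte_fin; apply: le_lt_trans st; apply: ereal_sup_ubound.
exists (cyl_time i) => //=; rewrite in_itv/=.
by have /andP[/ltW -> /ltW ->] := cyl_time_itv i.
Qed.

End Cylinders.

(** * Cameron-Martin paths *)

Section Inner.
Context (R : realType) (n : nat) (M : metricType R) (S : smooth_structure n M).
Context (g : riemannian_metric S) (x : M).
Implicit Types (v w : 'rV[R]_n) (a b : R).

Lemma innerE v w : inner g x v w =
  \sum_j (\sum_i v 0 i * gram g x i j) * w 0 j.
Proof.
rewrite /inner /bilin mxE; apply: eq_bigr => j _.
by rewrite !mxE.
Qed.

Lemma inner_linl a b v v' w :
  inner g x (a *: v + b *: v') w = a * inner g x v w + b * inner g x v' w.
Proof. by rewrite /inner /bilin !mulmxDl -!scalemxAl !mxE. Qed.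

Lemma innerC v w : inner g x v w = inner g x w v.
Proof.
rewrite /inner /bilin -[v *m _ *m _]trmxK mxE.
by rewrite !trmx_mul trmxK gram_sym mulmxA.
Qed.

Lemma inner_ge0 v : 0 <= inner g x v v.
Proof.
have [->|v0] := eqVneq v 0; last exact/ltW/gram_posdef.
by rewrite /inner /bilin !mul0mx mxE.
Qed.

Lemma inner_sqr_le a b v w :
  inner g x (a *: v + b *: w) (a *: v + b *: w) <=
  2 * a ^+ 2 * inner g x v v + 2 * b ^+ 2 * inner g x w w.
Proof.
have := inner_ge0 (a *: v + (- b) *: w).
rewrite !inner_linl ![inner g x _ (_ + _)]innerC.
rewrite !inner_linl [inner g x w v]innerC.
by move=> H; lra.
Qed.

Lemma norm_inner_le v w : `|inner g x v w| <= inner g x v v + inner g x w w.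
Proof.
have := inner_ge0 (1 *: v + (- 1) *: w); have := inner_ge0 (1 *: v + 1 *: w).
have := inner_ge0 v; have := inner_ge0 w.
rewrite !inner_linl ![inner g x _ (_ + _)]innerC.
rewrite !inner_linl [inner g x w v]innerC.
by move=> ? ? ? ?; rewrite ler_norml; apply/andP; split; lra.
Qed.

(** Coordinates are inner products with fixed vectors, so that square
    integrability in the sense of the metric makes them integrable. *)
Lemma coord_inner i : exists w, forall v, v 0 i = inner g x v w.
Proof.
have G_unit : gram g x \in unitmx.
  rewrite -row_free_unit; apply/inj_row_free => v v0; apply/eqP.
  apply: contraT => vn0.
  have := gram_posdef g x vn0.
  by rewrite /bilin v0 mul0mx mxE ltxx.
exists ((invmx (gram g x) *m delta_mx i 0)^T) => v.
rewrite /inner /bilin trmxK mulmxA mulmxK// -colE.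
by rewrite !mxE.
Qed.

End Inner.

Section CameronMartin.
Context (R : realType) (n : nat) (M : metricType R) (S : smooth_structure n M).
Context (g : riemannian_metric S) (T : R) (x0 : M).
Implicit Types (phi psi : R -> 'rV[R]_n) (a b : R).

Local Notation Leb := (@lebesgue_measure R).

Definition measurable_path phi :=
  forall i, measurable_fun `[0, T] (fun s => phi s 0 i).

Lemma measurable_path_lin a b phi psi :
  measurable_path phi -> measurable_path psi ->
  measurable_path (fun s => a *: phi s + b *: psi s).
Proof.
move=> mphi mpsi i; rewrite (_ : (fun s => _) =
    (fun s => a * phi s 0 i + b * psi s 0 i)); last first.
  by apply/funext => s; rewrite !mxE.
by apply: measurable_funD; apply: measurable_funM => //; exact: measurable_cst.
Qed.

Lemma measurable_path_inner phi psi :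
  measurable_path phi -> measurable_path psi ->
  measurable_fun `[0, T] (fun s => inner g x0 (phi s) (psi s)).
Proof.
move=> mphi mpsi.
rewrite (_ : (fun s => _) = (fun s =>
    \sum_j (\sum_i phi s 0 i * gram g x0 i j) * psi s 0 j)); last first.
  by apply/funext => s; rewrite innerE.
apply: measurable_sum => j; apply: measurable_funM => //.
by apply: measurable_sum => i; apply: measurable_funM => //;
  exact: measurable_cst.
Qed.

Lemma cm_norm2_ge0 phi : (0 <= cm_norm2 g T x0 phi)%E.
Proof. by apply: integral_ge0 => s _; rewrite lee_fin inner_ge0. Qed.

Lemma cm_norm2_lin_le a b phi psi :
  measurable_path phi -> measurable_path psi ->
  (cm_norm2 g T x0 (fun s => a *: phi s + b *: psi s)%R <=
   (2 * a ^+ 2)%:E * cm_norm2 g T x0 phi +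
   (2 * b ^+ 2)%:E * cm_norm2 g T x0 psi)%E.
Proof.
move=> mphi mpsi.
have m1 := measurable_path_inner mphi mphi.
have m2 := measurable_path_inner mpsi mpsi.
have m3 := measurable_path_inner (measurable_path_lin a b mphi mpsi)
  (measurable_path_lin a b mphi mpsi).
have p (c : R) : 0 <= 2 * c ^+ 2 by rewrite mulr_ge0// sqr_ge0.
rewrite /cm_norm2 -!ge0_integralZl_EFin//; last first.
- by move/measurable_EFinP : m1.
- by move=> s _; rewrite lee_fin inner_ge0.
- by move/measurable_EFinP : m2.
- by move=> s _; rewrite lee_fin inner_ge0.
rewrite -ge0_integralD//.
- apply: ge0_le_integral => //.
  + by move=> s _; rewrite lee_fin inner_ge0.
  + by move/measurable_EFinP : m3.
  + by apply: emeasurable_funD; apply: emeasurable_funM => //;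
      apply/measurable_EFinP.
  + move=> s _; rewrite -!EFinM -EFinD lee_fin.
    exact: inner_sqr_le.
- by move=> s _; rewrite -EFinM lee_fin mulr_ge0// inner_ge0.
- by apply: emeasurable_funM => //; apply/measurable_EFinP.
- by move=> s _; rewrite -EFinM lee_fin mulr_ge0// inner_ge0.
- by apply: emeasurable_funM => //; apply/measurable_EFinP.
Qed.

Definition finite_path phi :=
  measurable_path phi /\ (cm_norm2 g T x0 phi < +oo)%E.

Lemma finite_path_integrable phi : finite_path phi ->
  Leb.-integrable `[0, T] (fun s => (inner g x0 (phi s) (phi s))%:E).
Proof.
move=> [mphi fphi]; apply/integrableP; split.
  by apply/measurable_EFinP; exact: measurable_path_inner.
under eq_integral => s _ do rewrite abse_EFin ger0_norm ?inner_ge0//.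
exact: fphi.
Qed.

Lemma finite_path_inner_integrable phi psi :
  finite_path phi -> finite_path psi ->
  Leb.-integrable `[0, T] (fun s => (inner g x0 (phi s) (psi s))%:E).
Proof.
move=> fphi fpsi.
apply: le_integrable (integrableD _ (finite_path_integrable fphi)
  (finite_path_integrable fpsi)) => //.
  apply/measurable_EFinP.
  by apply: measurable_path_inner; [case: fphi|case: fpsi].
move=> s _ /=; rewrite lee_fin [leRHS]ger0_norm.
  exact: norm_inner_le.
by rewrite addr_ge0// inner_ge0.
Qed.

Lemma cst_path_finite (w : 'rV[R]_n) : finite_path (fun=> w).
Proof.
split; first by move=> i; exact: measurable_cst.
rewrite /cm_norm2 integral_cst//= lebesgue_measure_itv/=.
by case: ifP => _; rewrite -?EFinB -?EFinM ?mule0 ltry.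
Qed.

Lemma finite_path_coord_integrable phi i : finite_path phi ->
  Leb.-integrable `[0, T] (fun s => (phi s 0 i)%:E).
Proof.
move=> fphi; have [w wE] := coord_inner g x0 i.
rewrite (_ : (fun s => _) = (fun s => (inner g x0 (phi s) w)%:E)); last first.
  by apply/funext => s; rewrite wE.
exact: finite_path_inner_integrable fphi (cst_path_finite w).
Qed.

Lemma cm_inner_linl a b phi psi xi :
  finite_path phi -> finite_path psi -> finite_path xi ->
  cm_inner g T x0 (fun s => a *: phi s + b *: psi s) xi =
  a * cm_inner g T x0 phi xi + b * cm_inner g T x0 psi xi.
Proof.
move=> fphi fpsi fxi; rewrite /cm_inner.
have i1 := finite_path_inner_integrable fphi fxi.
have i2 := finite_path_inner_integrable fpsi fxi.
rewrite -!RintegralZl//.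
rewrite -RintegralD//; last 2 first.
- exact: integrableZl i1.
- exact: integrableZl i2.
by apply: eq_Rintegral => s _; rewrite inner_linl.
Qed.

Lemma cm_path_lin a b phi psi : 0 <= T -> finite_path phi -> finite_path psi ->
  cm_path (fun s => a *: phi s + b *: psi s) T =
  a *: cm_path phi T + b *: cm_path psi T.
Proof.
move=> T0 fphi fpsi; apply/rowP => i; rewrite !mxE.
have i1 := finite_path_coord_integrable i fphi.
have i2 := finite_path_coord_integrable i fpsi.
rewrite -!RintegralZl//.
rewrite -RintegralD//; last 2 first.
- exact: integrableZl i1.
- exact: integrableZl i2.
by apply: eq_Rintegral => s _; rewrite !mxE.
Qed.

Lemma finite_path_lin a b phi psi : finite_path phi -> finite_path psi ->
  finite_path (fun s => a *: phi s + b *: psi s).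
Proof.
move=> [m1 f1] [m2 f2]; split; first exact: measurable_path_lin.
apply: le_lt_trans (cm_norm2_lin_le a b m1 m2) _.
have [r1 <-] : exists r : R, r%:E = cm_norm2 g T x0 phi.
  exists (fine (cm_norm2 g T x0 phi)).
  by rewrite fineK// ge0_fin_numE// cm_norm2_ge0.
have [r2 <-] : exists r : R, r%:E = cm_norm2 g T x0 psi.
  exists (fine (cm_norm2 g T x0 psi)).
  by rewrite fineK// ge0_fin_numE// cm_norm2_ge0.
by rewrite -!EFinM -EFinD ltry.
Qed.

End CameronMartin.

(** * Sections of the Bismut tangent bundle *)

Section Sections.
Context (R : realType) (n : nat) (M : metricType R) (S : smooth_structure n M).
Context (g : riemannian_metric S) (T : R) (x0 : M).
Context (mu : probability (path_space T x0) R).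
Context (par : path_space T x0 -> R -> 'M[R]_n).
Implicit Types G : path_space T x0 -> R -> 'rV[R]_n.

Let DT : set (path_space T x0 * measurableTypeR R) :=
  [set: path_space T x0] `*` (`[0, T] : set (measurableTypeR R)).

Let mD : measurable DT.
Proof. exact: measurableX. Qed.

Lemma measurable_section_path G sigma :
  measurable_section G -> measurable_path T (G sigma).
Proof.
move=> mG i.
apply: (measurable_comp mD _ (mG i)
  (g := fun s : measurableTypeR R => (sigma, s))) => //.
- by move=> _ [s sT <-].
- exact: measurable_funTS (pair1_measurable sigma).
Qed.

(** Tonelli's theorem, with [G] extended by 0 outside of [[0, T]]. *)
Lemma measurable_cm_norm2 G : measurable_section G ->
  measurable_fun setT (fun sigma => cm_norm2 g T x0 (G sigma)).
Proof.
move=> mG.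
pose h (p : path_space T x0 * measurableTypeR R) :=
  (inner g x0 (G p.1 p.2) (G p.1 p.2))%:E.
have mh : measurable_fun DT h.
  apply/measurable_EFinP.
  rewrite (_ : (fun p => _) = (fun p =>
    \sum_j (\sum_i G p.1 p.2 0 i * gram g x0 i j) * G p.1 p.2 0 j)); last first.
    by apply/funext => p; rewrite innerE.
  apply: measurable_sum => j; apply: measurable_funM; last exact: mG.
  apply: measurable_sum => i; apply: measurable_funM; first exact: mG.
  exact: measurable_cst.
have mhr := (measurable_restrictT _ mD).1 mh.
have := @measurable_fun_fubini_tonelli_F _ _ _ _ R (@lebesgue_measure R) _ mhr.
have h0 p : (0 <= (h \_ DT) p)%E.
  by rewrite patchE; case: ifP => // _; rewrite lee_fin inner_ge0.
move=> /(_ h0); congr measurable_fun; apply/funext => sigma.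
rewrite /fubini_F /cm_norm2 [RHS]integral_mkcond; apply: eq_integral => s _.
rewrite !patchE; congr (if _ then _ else _).
by apply/idP/idP; rewrite !inE => //= -[].
Qed.

Lemma measurable_section_lin (a b : path_space T x0 -> R) G G' :
  measurable_fun setT a -> measurable_fun setT b ->
  measurable_section G -> measurable_section G' ->
  measurable_section
    (fun sigma s => a sigma *: G sigma s + b sigma *: G' sigma s).
Proof.
move=> ma mb mG mG' i.
rewrite (_ : (fun p => _) = (fun p =>
    a p.1 * G p.1 p.2 0 i + b p.1 * G' p.1 p.2 0 i)).
  have mfst (c : path_space T x0 -> R) : measurable_fun setT c ->
    measurable_fun DT (fun p => c p.1).
    move=> mc; apply: measurable_funTS.
    exact: measurableT_comp mc measurable_fst.
  by apply: measurable_funD; apply: measurable_funM;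
    [exact: mfst|exact: mG|exact: mfst|exact: mG'].
by apply/funext => p; rewrite !mxE.
Qed.

Lemma cameron_martin_finite phi :
  cameron_martin g mu phi -> finite_path g T x0 phi.
Proof. by case. Qed.

Lemma is_gradient_lin (F G H : cylinder S T) sigma a b phi psi : 0 <= T ->
  (forall w, cyl_diff H sigma w =
     a * cyl_diff F sigma w + b * cyl_diff G sigma w) ->
  is_gradient_at g mu par F sigma phi -> is_gradient_at g mu par G sigma psi ->
  is_gradient_at g mu par H sigma (fun s => a *: phi s + b *: psi s).
Proof.
move=> T0 HE [cphi Fphi] [cpsi Gpsi].
have fphi := cameron_martin_finite cphi.
have fpsi := cameron_martin_finite cpsi.
split.
  have [m f] := finite_path_lin a b fphi fpsi.
  split=> // fixed; have [_ _ /(_ fixed) phi0] := cphi.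
  have [_ _ /(_ fixed) psi0] := cpsi.
  by rewrite (cm_path_lin a b T0 fphi fpsi) phi0 psi0 !scaler0 addr0.
move=> xi cxi; have fxi := cameron_martin_finite cxi.
by rewrite cm_inner_linl// Fphi// Gpsi// HE.
Qed.

Lemma cyl_gradient_lin (F G H : cylinder S T) GF GG
    (a b : path_space T x0 -> R) : 0 <= T ->
  measurable_fun setT a -> measurable_fun setT b ->
  (forall sigma w, cyl_diff H sigma w =
     a sigma * cyl_diff F sigma w + b sigma * cyl_diff G sigma w) ->
  cyl_gradient g mu par F GF -> cyl_gradient g mu par G GG ->
  cyl_gradient g mu par H
    (fun sigma s => a sigma *: GF sigma s + b sigma *: GG sigma s).
Proof.
move=> T0 ma mb HE [mF gF] [mG gG]; split; first exact: measurable_section_lin.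
near=> sigma; apply: is_gradient_lin (HE sigma) _ _ => //.
  by near: sigma.
by near: sigma.
Unshelve. all: by end_near. Qed.

End Sections.

(** Along a subsequence the integrals are summable; then so are the functions,
    almost everywhere. *)
Lemma ae_cvg_subsequence d (X : measurableType d) (R : realType)
    (mu : probability X R) (h : nat -> X -> \bar R) :
  (forall m, measurable_fun setT (h m)) -> (forall m x, 0 <= h m x)%E ->
  (fun m => \int[mu]_x h m x)%E @ \oo --> 0%E ->
  exists k : nat -> nat, (forall m, (m <= k m)%N) /\
    {ae mu, forall x, h (k m) x @[m --> \oo] --> 0%E}.
Proof.
move=> mh h0 hcvg.
have small m : exists k, (m <= k)%N /\
    (\int[mu]_x h k x <= (1 / (2 ^ m.+1)%:R)%:E)%E.
  have e0 : (0 < (1 / (2 ^ m.+1)%:R : R)%:E)%E.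
    by rewrite lte_fin divr_gt0// ltr0n expn_gt0.
  near \oo => k; exists k; split; first by near: k; exact: nbhs_infty_ge.
  apply: ltW; near: k.
  apply: (hcvg [set y | (y < (1 / (2 ^ m.+1)%:R : R)%:E)%E]).
  by apply: open_nbhs_nbhs; split => //; exact: open_ereal_lt_ereal.
have [k kP] := choice small.
exists k; split; first by move=> m; have [] := kP m.
pose s x := (\sum_(0 <= m <oo) h (k m) x)%E.
have s0 x : (0 <= s x)%E by exact: nneseries_ge0.
have sint : mu.-integrable setT s.
  apply/integrableP; split; first exact: ge0_emeasurable_sum.
  under eq_integral => x _ do rewrite gee0_abs//.
  rewrite integral_nneseries//.
  apply: (@le_lt_trans _ _ 1%E); last exact: ltry.
  have := @epsilon_trick R (fun=> 0%E) 1%R xpredT (fun=> lexx _) ler01.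
  rewrite [X in (_ <= X + _)%E]eseries0// add0e; apply: le_trans.
  apply: lee_nneseries => [i _ _|m _]; first exact: integral_ge0.
  by rewrite add0e; have [] := kP m.
have := integrable_ae measurableT sint; apply: filterS => x /(_ I) sx.
have tail := @nneseries_tail_cvg R (fun m => h (k m) x) xpredT _ _.
apply: squeeze_cvge (cvg_cst 0%E) (tail _ _) => //; last first.
  by move: sx; rewrite ge0_fin_numE.
near=> m; rewrite h0/=.
have := @nneseries_lim_ge R (fun m => h (k m) x) xpredT m m.+1
  (fun n _ _ => h0 _ _).
by rewrite big_nat1.
Unshelve. all: by end_near. Qed.

(** * Products in the Sobolev space *)

Section NonnegIntegrals.
Context d (X : measurableType d) (R : realType) (mu : probability X R).
Implicit Types (h : X -> \bar R) (hs : nat -> X -> \bar R) (v : X -> R).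

Definition nonneg_mfun h := measurable_fun setT h /\ forall x, (0 <= h x)%E.

Lemma nonneg_mfun_sqr v : measurable_fun setT v ->
  nonneg_mfun (fun x => (v x ^+ 2)%:E).
Proof.
move=> mv; split=> [|x]; last by rewrite lee_fin sqr_ge0.
by apply/measurable_EFinP; exact: measurable_funX.
Qed.

Lemma nonneg_mfun_cst (c : R) : 0 <= c -> nonneg_mfun (fun=> c%:E).
Proof. by move=> c0; split=> [|x]; [exact: measurable_cst|rewrite lee_fin]. Qed.

Lemma nonneg_mfunD h1 h2 : nonneg_mfun h1 -> nonneg_mfun h2 ->
  nonneg_mfun (fun x => h1 x + h2 x)%E.
Proof.
move=> [m1 p1] [m2 p2]; split; first exact: emeasurable_funD.
by move=> x; exact: adde_ge0.
Qed.

Lemma nonneg_mfunM h1 h2 : nonneg_mfun h1 -> nonneg_mfun h2 ->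
  nonneg_mfun (fun x => h1 x * h2 x)%E.
Proof.
move=> [m1 p1] [m2 p2]; split; first exact: emeasurable_funM.
by move=> x; exact: mule_ge0.
Qed.

Lemma integral_nonnegD h1 h2 : nonneg_mfun h1 -> nonneg_mfun h2 ->
  (\int[mu]_x (h1 x + h2 x) = \int[mu]_x h1 x + \int[mu]_x h2 x)%E.
Proof. by move=> [m1 p1] [m2 p2]; exact: ge0_integralD. Qed.

Lemma integral_nonnegZ (c : R) h : 0 <= c -> nonneg_mfun h ->
  (\int[mu]_x (c%:E * h x) = c%:E * \int[mu]_x h x)%E.
Proof.
by move=> c0 [m p]; exact: ge0_integralZl.
Qed.

Lemma integral_nonneg_le h1 h2 : nonneg_mfun h1 -> nonneg_mfun h2 ->
  {ae mu, forall x, (h1 x <= h2 x)%E} ->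
  (\int[mu]_x h1 x <= \int[mu]_x h2 x)%E.
Proof.
move=> [m1 p1] [m2 p2] h12; apply: ae_ge0_le_integral => //.
by apply: filterS h12 => x hx _.
Qed.

Lemma integral_cvg0D hs hs' :
  (forall m, nonneg_mfun (hs m)) -> (forall m, nonneg_mfun (hs' m)) ->
  (\int[mu]_x hs m x)%E @[m --> \oo] --> 0%E ->
  (\int[mu]_x hs' m x)%E @[m --> \oo] --> 0%E ->
  (\int[mu]_x (hs m x + hs' m x))%E @[m --> \oo] --> 0%E.
Proof.
move=> p p' c c'; under eq_fun do rewrite integral_nonnegD//.
by have := cvgeD _ c c'; rewrite adde0; apply.
Qed.

Lemma integral_cvg0Z (c : R) hs : 0 <= c -> (forall m, nonneg_mfun (hs m)) ->
  (\int[mu]_x hs m x)%E @[m --> \oo] --> 0%E ->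
  (\int[mu]_x (c%:E * hs m x))%E @[m --> \oo] --> 0%E.
Proof.
move=> c0 p ch; under eq_fun do rewrite integral_nonnegZ//.
by rewrite -(mule0 c%:E); exact: cvgeZl.
Qed.

Lemma integral_cst_lty (c : R) : (\int[mu]_x c%:E < +oo)%E.
Proof.
by rewrite integral_cst// [X in (_ * X)%E]probability_setT mule1 ltry.
Qed.

Lemma le_sqr_norm (x b : R) : `|x| <= b -> x ^+ 2 <= b ^+ 2.
Proof.
move=> xb; rewrite -[x ^+ 2]real_normK ?num_real//.
by rewrite lerXn2r// ?nnegrE// (le_trans _ xb).
Qed.

Lemma integral_cvg0_dominated (c : nat -> X -> R) h (B : R) :
  (forall m, measurable_fun setT (c m)) -> (forall m x, `|c m x| <= B) ->
  {ae mu, forall x, c m x @[m --> \oo] --> 0} ->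
  nonneg_mfun h -> (\int[mu]_x h x < +oo)%E ->
  (\int[mu]_x ((c m x ^+ 2)%:E * h x))%E @[m --> \oo] --> 0%E.
Proof.
move=> mc cB c0 [mh h0] hfin.
have hint : mu.-integrable setT h.
  apply/integrableP; split => //.
  by under eq_integral => x _ do rewrite gee0_abs//.
have hintB : mu.-integrable setT (fun x => (B ^+ 2)%:E * h x)%E.
  exact: integrableZl.
have [] := @dominated_convergence _ _ _ mu setT measurableT
  (fun m x => (c m x ^+ 2)%:E * h x)%E (cst 0%E) (fun x => (B ^+ 2)%:E * h x)%E.
- move=> m; apply: emeasurable_funM => //.
  by apply/measurable_EFinP; exact: measurable_funX.
- exact: measurable_cst.
- have := integrable_ae measurableT hint.
  apply: filterS2 c0 => x cx /(_ I) hx _.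
  rewrite -(fineK hx).
  have : (c m x ^+ 2 * fine (h x)) @[m --> \oo] --> (0 ^+ 2 * fine (h x) : R).
    by apply: cvgM; [exact: (cvgM cx cx)|exact: cvg_cst].
  rewrite expr0n/= mul0r => H.
  apply: cvg_EFin; first by apply: nearW => m; rewrite -EFinM.
  exact: H.
- exact: hintB.
- apply: nearW => x m _.
  rewrite gee0_abs; last by rewrite mule_ge0// lee_fin sqr_ge0.
  by apply: lee_wpmul2r => //; rewrite lee_fin le_sqr_norm.
by move=> _ _; rewrite integral0.
Qed.

Lemma sqr_integral_lty v (B : R) :
  measurable_fun setT v -> (forall x, `|v x| <= B) ->
  (\int[mu]_x (v x ^+ 2)%:E < +oo)%E.
Proof.
move=> mv vB; apply: (@le_lt_trans _ _ (\int[mu]_x (B ^+ 2)%:E)%E).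
  apply: integral_nonneg_le; first exact: nonneg_mfun_sqr.
    exact/nonneg_mfun_cst/sqr_ge0.
  by apply: nearW => x; rewrite lee_fin le_sqr_norm.
exact: integral_cst_lty.
Qed.

End NonnegIntegrals.

Lemma cvg_subsequence (U : topologicalType) (v : nat -> U) (l : U)
    (k : nat -> nat) :
  (forall m, (m <= k m)%N) -> v @ \oo --> l -> v (k m) @[m --> \oo] --> l.
Proof.
move=> mk vl; apply: (@cvg_comp _ _ _ k v \oo \oo) => //.
move=> A [N _ NA]; exists N => // m /= Nm; apply: NA => /=.
exact: leq_trans (mk m).
Qed.

Lemma cvg_sqr_diff (R : realType) (p : nat -> R) (l : R) (h : nat -> \bar R) :
  (forall m, (((l - p m) ^+ 2)%:E <= h m)%E) -> h @ \oo --> 0%E ->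
  p @ \oo --> l.
Proof.
move=> ph h0; have : ((l - p m) ^+ 2)%:E @[m --> \oo] --> (0%E : \bar R).
  apply: squeeze_cvge (cvg_cst 0%E) h0 => //.
  by apply: nearW => m; rewrite ph lee_fin sqr_ge0.
move=> /fine_cvg /= sq0.
apply/cvgrPdist_lt => e e0.
have e20 : 0 < e ^+ 2 by rewrite exprn_gt0.
move/cvgrPdist_lt : sq0 => /(_ _ e20); apply: filterS => m /=.
rewrite sub0r normrN ger0_norm ?sqr_ge0//.
by rewrite -[X in X < _]real_normK ?num_real// ltr_pXn2r// ?nnegrE// ltW.
Qed.

Section SobolevMul.
Context (R : realType) (n : nat) (M : metricType R) (S : smooth_structure n M).
Context (g : riemannian_metric S) (T : R) (x0 : M).
Context (mu : probability (path_space T x0) R).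
Context (par : path_space T x0 -> R -> 'M[R]_n).

Local Notation nrm2 := (cm_norm2 g T x0).

Lemma measurable_sectionB (G G' : path_space T x0 -> R -> 'rV[R]_n) :
  measurable_section G -> measurable_section G' ->
  measurable_section (fun sigma s => G sigma s - G' sigma s).
Proof.
move=> mG mG'; rewrite (_ : (fun sigma s => _) = (fun sigma s =>
    (cst 1 : path_space T x0 -> R) sigma *: G sigma s
    + (cst (-1) : path_space T x0 -> R) sigma *: G' sigma s)).
  by apply: measurable_section_lin => //; exact: measurable_cst.
by apply/funext => sigma; apply/funext => s; rewrite scale1r scaleN1r.
Qed.

Lemma nonneg_mfun_nrm2 (G : path_space T x0 -> R -> 'rV[R]_n) :
  measurable_section G -> nonneg_mfun (fun sigma => nrm2 (G sigma)).
Proof.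
by move=> mG; split; [exact: measurable_cm_norm2|move=> x; exact: cm_norm2_ge0].
Qed.

Lemma test_function_continuous (phi phi' : R -> R) :
  test_function phi phi' -> continuous phi.
Proof.
move=> t x; apply: differentiable_continuous; apply/derivable1_diffP.
by have [] := test_derive t x.
Qed.

Lemma four_terms_le (X Y N1 N2 N3 N4 : \bar R) (a b a' b' B : R) :
  (0 <= N1 -> 0 <= N2 -> 0 <= N3 -> 0 <= N4 ->
  X <= (2 * a ^+ 2)%:E * N1 + (2 * b ^+ 2)%:E * N2 ->
  Y <= (2 * a' ^+ 2)%:E * N3 + (2 * b' ^+ 2)%:E * N4 ->
  (`|a'| <= B)%R -> (`|b'| <= B)%R ->
  (2 * 1 ^+ 2)%:E * X + (2 * 1 ^+ 2)%:E * Y <=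
  4%:E * ((a ^+ 2)%:E * N1) + 4%:E * ((b ^+ 2)%:E * N2) +
  (4 * B ^+ 2)%:E * N3 + (4 * B ^+ 2)%:E * N4)%E.
Proof.
move=> n1 n2 n3 n4 H1 H2 aB bB; rewrite expr1n mulr1.
have two0 : (0 <= 2%:E :> \bar R)%E by rewrite lee_fin.
apply: le_trans (leeD (lee_wpmul2l two0 H1) (lee_wpmul2l two0 H2)) _.
have p (c : R) : (0 <= (2 * c ^+ 2)%:E)%E by rewrite lee_fin mulr_ge0// sqr_ge0.
rewrite [in leLHS]ge0_muleDr ?mule_ge0//.
rewrite [in X in (_ + X <= _)%E]ge0_muleDr ?mule_ge0//.
rewrite !muleA -!EFinM -addeA.
have e x : (2 * (2 * x ^+ 2) = 4 * x ^+ 2 :> R)%R by ring.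
rewrite !e -addeA -[leRHS]addeA; apply: leeD => //; apply: leeD => //.
have c x : `|x| <= B -> ((4 * x ^+ 2)%:E <= (4 * B ^+ 2)%:E :> \bar R)%E.
  by move=> xB; rewrite lee_fin ler_pM2l// le_sqr_norm.
by apply: leeD; apply: lee_wpmul2r; rewrite ?c.
Qed.

(** The difference of two gradients of product form splits into differences of
    the scalar factors, to be handled by dominated convergence, and differences
    of the gradients of the factors, to be handled by L^2 convergence. *)
Lemma cm_norm2_diff_le (a b a' b' B : R) (f1 u1 f2 u2 : R -> 'rV[R]_n) :
  measurable_path T f1 -> measurable_path T u1 ->
  measurable_path T (fun s => f1 s - f2 s) ->
  measurable_path T (fun s => u1 s - u2 s) ->
  `|a'| <= B -> `|b'| <= B ->
  (nrm2 (fun s => (a *: f1 s + b *: u1 s) - (a' *: f2 s + b' *: u2 s))%R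
   <= 4%:E * (((a - a') ^+ 2)%:E * nrm2 f1) +
      4%:E * (((b - b') ^+ 2)%:E * nrm2 u1) +
      (4 * B ^+ 2)%:E * nrm2 (fun s => f1 s - f2 s)%R +
      (4 * B ^+ 2)%:E * nrm2 (fun s => u1 s - u2 s)%R)%E.
Proof.
move=> mf mu1 mdf mdu aB bB.
rewrite (_ : (fun s => _)%R = (fun s =>
    1 *: ((a - a') *: f1 s + (b - b') *: u1 s) +
    1 *: (a' *: (f1 s - f2 s) + b' *: (u1 s - u2 s)))); last first.
  apply/funext => s; rewrite !scale1r; apply/rowP => i; rewrite !mxE; ring.
have H1 := cm_norm2_lin_le g x0 (a - a') (b - b') mf mu1.
have H2 := cm_norm2_lin_le g x0 a' b' mdf mdu.
apply: le_trans (cm_norm2_lin_le g x0 1 1 (measurable_path_lin _ _ mf mu1)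
   (measurable_path_lin _ _ mdf mdu)) _.
apply: (four_terms_le _ _ _ _ H1 H2); by [|exact: cm_norm2_ge0].
Qed.

(** The approximating cylinder functions need neither be bounded nor converge
    almost surely.  The boundedness of [phi], [theta] and their derivatives
    replaces the former, passing to a subsequence the latter; as the gradients
    of [f] and [u] are square integrable, they dominate the terms in which the
    scalar factors vary. *)
Lemma sobolev_gradient_mul (phi theta phi' theta' : R -> R) f u Gf Gu :
  0 <= T -> test_function phi phi' -> test_function theta theta' ->
  sobolev_gradient g mu par f Gf ->
  (\int[mu]_sigma nrm2 (Gf sigma) < +oo)%E ->
  sobolev_gradient g mu par u Gu ->
  (\int[mu]_sigma nrm2 (Gu sigma) < +oo)%E ->
  sobolev_gradient g mu par (fun sigma => phi (f sigma) * theta (u sigma))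
    (fun sigma s => (phi' (f sigma) * theta (u sigma)) *: Gf sigma s +
                    (phi (f sigma) * theta' (u sigma)) *: Gu sigma s).
Proof.
move=> T0 tphi ttheta [mf _ mGf [F [GF [gF Fcv GFcv]]]] Gf_fin
  [mu_ _ mGu [H [GH [gH Hcv GHcv]]]] Gu_fin.
have cphi := test_function_continuous tphi.
have ctheta := test_function_continuous ttheta.
have cphi' := test_derive_continuous tphi.
have ctheta' := test_derive_continuous ttheta.
have [b1 b10 phiB] := test_bounded tphi.
have [b2 b20 thetaB] := test_bounded ttheta.
pose B := b1 * b2.
have mcomp (c : R -> R) (v : path_space T x0 -> R) : continuous c ->
    measurable_fun setT v -> measurable_fun setT (fun x => c (v x)).
  by move=> cc mv; apply: measurableT_comp mv; exact: continuous_measurable_fun.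
have mprod (c c' : R -> R) (v v' : path_space T x0 -> R) :
    continuous c -> continuous c' -> measurable_fun setT v ->
    measurable_fun setT v' ->
    measurable_fun setT (fun x => c (v x) * c' (v' x)).
  by move=> ? ? ? ?; apply: measurable_funM; exact: mcomp.
have bprod (c c' : R -> R) :
    (forall x, `|c x| <= b1) -> (forall x, `|c' x| <= b2) ->
    forall x y, `|c x * c' y| <= B.
  by move=> cB c'B x y; rewrite normrM ler_pM.
have Bp : forall x, `|phi x| <= b1 by move=> x; have [] := phiB x.
have Bp' : forall x, `|phi' x| <= b1 by move=> x; have [] := phiB x.
have Bt : forall x, `|theta x| <= b2 by move=> x; have [] := thetaB x.
have Bt' : forall x, `|theta' x| <= b2 by move=> x; have [] := thetaB x.
split.
- exact: mprod.
- by apply: (@sqr_integral_lty _ _ _ mu _ B) => [|x];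
    [exact: mprod|exact: bprod].
- by apply: measurable_section_lin => //; exact: mprod.
have mF m : measurable_fun setT (fun x : path_space T x0 => cyl_eval (F m) x).
  exact: cyl_eval_measurable.
have mH m : measurable_fun setT (fun x : path_space T x0 => cyl_eval (H m) x).
  exact: cyl_eval_measurable.
have [k [mk kcv]] : exists k : nat -> nat, (forall m, (m <= k m)%N) /\
    {ae mu, forall sigma,
      cyl_eval (F (k m)) sigma @[m --> \oo] --> f sigma /\
      cyl_eval (H (k m)) sigma @[m --> \oo] --> u sigma}.
  pose hF m x := ((f x - cyl_eval (F m) x) ^+ 2)%:E.
  pose hH m x := ((u x - cyl_eval (H m) x) ^+ 2)%:E.
  have pF m : nonneg_mfun (hF m).
    by apply: nonneg_mfun_sqr; exact: measurable_funB.
  have pH m : nonneg_mfun (hH m).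
    by apply: nonneg_mfun_sqr; exact: measurable_funB.
  have pFH m := nonneg_mfunD (pF m) (pH m).
  have [k [mk kcv]] := ae_cvg_subsequence (fun m => (pFH m).1)
    (fun m => (pFH m).2) (integral_cvg0D pF pH Fcv Hcv).
  exists k; split => //; apply: filterS kcv => x hx.
  split; apply: cvg_sqr_diff hx => m.
  - by rewrite leeDl// lee_fin sqr_ge0.
  - by rewrite leeDr// lee_fin sqr_ge0.
have [K KP] :=
  choice (fun m => cylinder_mul x0 (F (k m)) (H (k m)) tphi ttheta).
pose a (sigma : path_space T x0) := phi' (f sigma) * theta (u sigma).
pose b (sigma : path_space T x0) := phi (f sigma) * theta' (u sigma).
pose a_ (m : nat) (sigma : path_space T x0) :=
  phi' (cyl_eval (F (k m)) sigma) * theta (cyl_eval (H (k m)) sigma).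
pose b_ (m : nat) (sigma : path_space T x0) :=
  phi (cyl_eval (F (k m)) sigma) * theta' (cyl_eval (H (k m)) sigma).
pose GK (m : nat) (sigma : path_space T x0) (s : R) : 'rV[R]_n :=
  a_ m sigma *: GF (k m) sigma s + b_ m sigma *: GH (k m) sigma s.
have prod_cvg (c c' : R -> R) : continuous c -> continuous c' ->
    {ae mu, forall sigma, (c (f sigma) * c' (u sigma) -
      c (cyl_eval (F (k m)) sigma) * c' (cyl_eval (H (k m)) sigma))
      @[m --> \oo] --> 0}.
  move=> cc cc'; apply: filterS kcv => x [Fx Hx].
  rewrite -[X in _ --> X](subrr (c (f x) * c' (u x))).
  apply: cvgB; first exact: cvg_cst.
  by apply: cvgM; [apply: continuous_cvg Fx; exact: cc|
    apply: continuous_cvg Hx; exact: cc'].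
have diff0 (c c' : R -> R) (h : path_space T x0 -> \bar R) :
    continuous c -> continuous c' ->
    (forall x, `|c x| <= b1) -> (forall x, `|c' x| <= b2) ->
    nonneg_mfun h -> (\int[mu]_x h x < +oo)%E ->
    (\int[mu]_x (((c (f x) * c' (u x) -
      c (cyl_eval (F (k m)) x) * c' (cyl_eval (H (k m)) x)) ^+ 2)%:E * h x))%E
      @[m --> \oo] --> 0%E.
  move=> cc cc' cB c'B hh hfin.
  apply: (@integral_cvg0_dominated _ _ _ mu _ h (B + B)) => //.
  - by move=> m; apply: measurable_funB; exact: mprod.
  - by move=> m x; rewrite (le_trans (ler_normB _ _))// lerD// bprod.
  - exact: prod_cvg.
exists K, GK; split.
- move=> m; have [_ KD] := KP m.
  by apply: cyl_gradient_lin KD (gF (k m)) (gH (k m)) => //; exact: mprod.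
- have := @diff0 phi theta (fun=> 1%E) cphi ctheta Bp Bt
    (nonneg_mfun_cst _ ler01) (integral_cst_lty mu 1).
  apply: cvg_trans (near_eq_cvg _); apply: nearW => m.
  by apply: eq_integral => x _; rewrite mule1 (KP m).1.
have mGF m : measurable_section (GF m) by have [] := gF m.
have mGH m : measurable_section (GH m) by have [] := gH m.
pose t1 (m : nat) x := (((a x - a_ m x) ^+ 2)%:E * nrm2 (Gf x))%E.
pose t2 (m : nat) x := (((b x - b_ m x) ^+ 2)%:E * nrm2 (Gu x))%E.
pose t3 (m : nat) x := nrm2 (fun s => Gf x s - GF (k m) x s).
pose t4 (m : nat) x := nrm2 (fun s => Gu x s - GH (k m) x s).
have ma_ m : measurable_fun setT (a_ m) by exact: mprod.
have mb_ m : measurable_fun setT (b_ m) by exact: mprod.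
have p1 m : nonneg_mfun (t1 m).
  apply: nonneg_mfunM (nonneg_mfun_nrm2 mGf).
  by apply: nonneg_mfun_sqr; apply: measurable_funB => //; exact: mprod.
have p2 m : nonneg_mfun (t2 m).
  apply: nonneg_mfunM (nonneg_mfun_nrm2 mGu).
  by apply: nonneg_mfun_sqr; apply: measurable_funB => //; exact: mprod.
have p3 m : nonneg_mfun (t3 m).
  by apply: nonneg_mfun_nrm2; exact: measurable_sectionB.
have p4 m : nonneg_mfun (t4 m).
  by apply: nonneg_mfun_nrm2; exact: measurable_sectionB.
have c1 : 0 <= 4 :> R by [].
have c2 : 0 <= 4 * B ^+ 2 by exact: mulr_ge0 c1 (sqr_ge0 _).
have pZ (c : R) h : 0 <= c -> nonneg_mfun h ->
    nonneg_mfun (fun x : path_space T x0 => c%:E * h x)%E.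
  by move=> cp; apply: nonneg_mfunM; exact: nonneg_mfun_cst.
have q1 m := pZ _ _ c1 (p1 m); have q2 m := pZ _ _ c1 (p2 m).
have q3 m := pZ _ _ c2 (p3 m); have q4 m := pZ _ _ c2 (p4 m).
have t1cv : (\int[mu]_x t1 m x)%E @[m --> \oo] --> 0%E.
  by apply: (diff0 phi' theta) => //; exact: nonneg_mfun_nrm2.
have t2cv : (\int[mu]_x t2 m x)%E @[m --> \oo] --> 0%E.
  by apply: (diff0 phi theta') => //; exact: nonneg_mfun_nrm2.
have bound0 := integral_cvg0D
  (fun m => nonneg_mfunD (nonneg_mfunD (q1 m) (q2 m)) (q3 m)) q4
  (integral_cvg0D (fun m => nonneg_mfunD (q1 m) (q2 m)) q3
    (integral_cvg0D q1 q2 (integral_cvg0Z c1 p1 t1cv)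
      (integral_cvg0Z c1 p2 t2cv))
    (integral_cvg0Z c2 p3 (cvg_subsequence mk GFcv)))
  (integral_cvg0Z c2 p4 (cvg_subsequence mk GHcv)).
apply: squeeze_cvge (cvg_cst 0%E) bound0; apply: nearW => m.
apply/andP; split; first by apply: integral_ge0 => x _; exact: cm_norm2_ge0.
apply: integral_nonneg_le.
- apply: nonneg_mfun_nrm2; apply: measurable_sectionB.
    by apply: measurable_section_lin => //; exact: mprod.
  exact: measurable_section_lin.
- exact: nonneg_mfunD (nonneg_mfunD (nonneg_mfunD (q1 m) (q2 m)) (q3 m)) (q4 m).
apply: nearW => x; apply: cm_norm2_diff_le; try exact: measurable_section_path.
- by apply: measurable_section_path (measurable_sectionB _ _).
- by apply: measurable_section_path (measurable_sectionB _ _).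
- exact: bprod.
- exact: bprod.
Qed.

End SobolevMul.

(** * The truncation and the cutoff *)

Section ScalarCalculus.
Context (R : realType).
Implicit Types (f g : R -> R) (x df dg : R).

Lemma is_derive_mul f g x df dg : is_derive x 1 f df -> is_derive x 1 g dg ->
  is_derive x 1 (fun y => f y * g y) (f x * dg + df * g x).
Proof.
move=> Df Dg; apply: is_derive_eq (is_deriveM Df Dg) _.
by rewrite /GRing.scale/= [df * _]mulrC.
Qed.

Lemma is_derive_inv f x df : f x != 0 -> is_derive x 1 f df ->
  is_derive x 1 (fun y => (f y)^-1) (- df * (f x)^-1 ^+ 2).
Proof.
move=> fx [Df <-]; apply: DeriveDef; first exact: derivableV.
by rewrite deriveV// /GRing.scale/= exprVn !mulNr mulrC.
Qed.

Lemma is_derive_expr j x :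
  is_derive x 1 (fun y : R => y ^+ j) (j%:R * x ^+ j.-1).
Proof.
apply: DeriveDef; first exact: exprn_derivable.
by rewrite exp_derive /GRing.scale/= mulr1.
Qed.

Lemma is_derive_pow (c : R) j x :
  is_derive x 1 (fun y : R => c * y ^+ j) (c * (j%:R * x ^+ j.-1)).
Proof.
apply: is_derive_eq
  (is_derive_mul (is_derive_cst c x 1) (is_derive_expr j x)) _.
by rewrite mul0r addr0.
Qed.

Lemma is_derive_addc (c : R) f x df : is_derive x 1 f df ->
  is_derive x 1 (fun y => c + f y) df.
Proof.
move=> Df; apply: is_derive_eq (is_deriveD (is_derive_cst c x 1) Df) _.
by rewrite add0r.
Qed.

Lemma continuous_mul f g : continuous f -> continuous g ->
  continuous (fun x => f x * g x).
Proof. by move=> cf cg x; apply: cvgM; [exact: cf|exact: cg]. Qed.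

Lemma continuous_add f g : continuous f -> continuous g ->
  continuous (fun x => f x + g x).
Proof. by move=> cf cg x; apply: cvgD; [exact: cf|exact: cg]. Qed.

Lemma continuous_inv f : (forall x, f x != 0) -> continuous f ->
  continuous (fun x => (f x)^-1).
Proof. by move=> f0 cf x; apply: cvgV; [exact: f0|exact: cf]. Qed.

Lemma continuous_pow (c : R) j : continuous (fun x : R => c * x ^+ j).
Proof.
apply: continuous_mul; first by move=> x; exact: cvg_cst.
exact: exprn_continuous.
Qed.

End ScalarCalculus.

Section Truncation.
Context (R : realType) (l : R).
Hypothesis l0 : 0 < l.

(** A bounded function that is close to the identity where [l * x ^+ 2] is
    small. *)
Definition trunc (x : R) : R := x * (1 + l * x ^+ 2)^-1.
Definition trunc' (x : R) : R := (1 - l * x ^+ 2) * ((1 + l * x ^+ 2)^-1) ^+ 2.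

Let d0 x : 0 < 1 + l * x ^+ 2.
Proof. by rewrite ltr_pwDl// mulr_ge0 ?sqr_ge0// ltW. Qed.

Lemma trunc_le x : `|trunc x| <= `|x|.
Proof.
rewrite normrM ler_piMr// normfV gtr0_norm// invf_le1//.
by rewrite lerDl mulr_ge0 ?sqr_ge0// ltW.
Qed.

Lemma trunc'_le x : `|trunc' x| <= 1.
Proof.
have lx : 0 <= l * x ^+ 2 by rewrite mulr_ge0 ?sqr_ge0// ltW.
rewrite /trunc' exprVn normrM normfV [`|_ ^+ 2|]ger0_norm ?sqr_ge0//.
rewrite ler_pdivrMr ?exprn_gt0// mul1r expr2 (@le_trans _ _ (1 + l * x ^+ 2))//.
  by rewrite ler_norml; apply/andP; split; lra.
by apply: ler_peMl; [exact: ltW|rewrite lerDl].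
Qed.

Lemma sqr_sub_trunc_le x N : `|x| <= N ->
  x ^+ 2 - trunc x ^+ 2 <= 2 * l * N ^+ 4.
Proof.
move=> xN; set t := l * x ^+ 2.
have t0 : 0 <= t by rewrite mulr_ge0 ?sqr_ge0// ltW.
have -> : x ^+ 2 - trunc x ^+ 2 = x ^+ 2 * (1 - (1 + t)^-1 ^+ 2).
  by rewrite /trunc -/t exprMn; ring.
have i1 : (1 + t)^-1 >= 1 - t.
  rewrite -[leRHS]div1r ler_pdivlMr; last exact: d0.
  by rewrite mulrDr mulr1 mulrBl mul1r; have := sqr_ge0 t; rewrite expr2; lra.
have i0 : 0 <= (1 + t)^-1 by rewrite invr_ge0 ltW// d0.
have i2 : (1 + t)^-1 <= 1 by rewrite invf_le1 ?d0// lerDl.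
apply: (@le_trans _ _ (x ^+ 2 * (2 * t))).
  rewrite ler_wpM2l ?sqr_ge0//.
  move: ((1 + t)^-1) i1 i0 i2 => i i1 i0 i2; rewrite expr2; nra.
rewrite /t mulrCA [leLHS](_ : _ = 2 * l * x ^+ 4); last by ring.
apply: ler_wpM2l; first by rewrite mulr_ge0// ltW.
have -> : x ^+ 4 = `|x| ^+ 4 by rewrite -normrX ger0_norm// exprn_even_ge0.
by rewrite lerXn2r// ?nnegrE// (le_trans _ xN).
Qed.

Lemma test_function_trunc : test_function trunc trunc'.
Proof.
split.
- apply: smooth_stableM; first exact: smooth_stable_id.
  apply: smooth_stableV => [x|]; first by rewrite gt_eqF// d0.
  apply: smooth_stableD; first exact: smooth_stable_cst.
  by apply: smooth_stableM; [exact: smooth_stable_cst|exact: smooth_stableX].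
- by rewrite /trunc mul0r.
- move=> x.
  have dn := is_derive_addc 1 (is_derive_pow l 2 x).
  have dnV := is_derive_inv (f := fun y => 1 + l * y ^+ 2)
    (lt0r_neq0 (d0 x)) dn.
  apply: is_derive_eq (is_derive_mul (is_derive_id x 1) dnV) _.
  by rewrite /trunc'/=; field; rewrite gt_eqF// d0.
- have cV : continuous (fun x : R => (1 + l * x ^+ 2)^-1).
    apply: continuous_inv => [x|]; first by rewrite gt_eqF// d0.
    by apply: continuous_add; [move=> x; exact: cvg_cst|exact: continuous_pow].
  apply: continuous_mul; last by apply: continuous_mul.
  rewrite (_ : (fun x => _) = (fun x : R => 1 + (- l) * x ^+ 2)).
    by apply: continuous_add; [move=> x; exact: cvg_cst|exact: continuous_pow].
  by apply/funext => x; rewrite mulNr.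
- exists (1 + l^-1); first by rewrite addr_gt0// invr_gt0.
  move=> x; split; last first.
    by rewrite (le_trans (trunc'_le x))// lerDl invr_ge0 ltW.
  rewrite /trunc normrM normfV [X in _ / X]gtr0_norm// ler_pdivrMr//.
  have il : 0 < l^-1 by rewrite invr_gt0.
  rewrite mulrDr mulr1 [X in _ <= _ + X]mulrDl mul1r mulKf ?gt_eqF//.
  have : 0 <= l * x ^+ 2 by rewrite mulr_ge0 ?sqr_ge0// ltW.
  rewrite -[x ^+ 2]real_normK ?num_real//.
  by have := sqr_ge0 (`|x| - 2^-1); rewrite expr2; lra.
Qed.

End Truncation.

Section Cutoff.
Context (R : realType) (e c : R) (k : nat).
Hypotheses (e0 : 0 < e) (c0 : 0 < c).
Let K := k.+1.

(** [near_zero] is 1 at 0 and small away from it; [near_infty] is small below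
    the level [c^-1 ^ (1 / 2K)] and large above it.  They bound
    both errors of the cutoff: the loss of mass in [one_sub_cutoff_le], the
    energy, up to a factor [K ^+ 2], in [sqr_id_cutoff'_le]. *)
Definition near_zero (y : R) : R := e * (e + y ^+ 2)^-1.
Definition near_infty (y : R) : R := c * y ^+ (2 * K).
Definition cutoff (y : R) : R := (1 - near_zero y) * (1 + near_infty y)^-1.
Definition cutoff' (y : R) : R := y * (e + y ^+ 2)^-1 *
  (2 * near_zero y * (1 + near_infty y)^-1
   - (2 * K)%:R * near_infty y * (1 + near_infty y)^-1 ^+ 2).

Let d0 y : 0 < e + y ^+ 2.
Proof. by rewrite ltr_pwDl// sqr_ge0. Qed.

Lemma near_infty_ge0 y : 0 <= near_infty y.
Proof. by rewrite mulr_ge0 ?(ltW c0)// exprn_even_ge0// oddM. Qed.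

Lemma near_zero_ge0 y : 0 <= near_zero y.
Proof. by rewrite mulr_ge0 ?(ltW e0)// invr_ge0 ltW. Qed.

Lemma near_zero_le1 y : near_zero y <= 1.
Proof. by rewrite ler_pdivrMr// mul1r lerDl sqr_ge0. Qed.

Let z1 y : 0 < 1 + near_infty y.
Proof. by rewrite ltr_pwDl// near_infty_ge0. Qed.

Let i_ge0 y : 0 <= (1 + near_infty y)^-1.
Proof. by rewrite invr_ge0 ltW. Qed.

Let i_le1 y : (1 + near_infty y)^-1 <= 1.
Proof. by rewrite invf_le1// lerDl near_infty_ge0. Qed.

Lemma cutoff_ge0 y : 0 <= cutoff y.
Proof. by rewrite mulr_ge0// subr_ge0 near_zero_le1. Qed.

Lemma cutoff_le1 y : cutoff y <= 1.
Proof.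
by rewrite mulr_ile1// ?subr_ge0 ?near_zero_le1// lerBlDr lerDl near_zero_ge0.
Qed.

Lemma one_sub_cutoff_le y : 1 - cutoff y <= near_zero y + near_infty y.
Proof.
have i1 : 1 - near_infty y <= (1 + near_infty y)^-1.
  rewrite -[leRHS]div1r ler_pdivlMr// mulrDr mulr1 mulrBl mul1r.
  by have := sqr_ge0 (near_infty y); rewrite expr2; lra.
have := near_zero_ge0 y; have := near_infty_ge0 y; have := near_zero_le1 y.
have := i_ge0 y; have := i_le1 y; rewrite /cutoff.
move: (near_zero y) (near_infty y) ((1 + near_infty y)^-1) i1 => w z i.
by move=> *; nra.
Qed.

Lemma one_sub_sqr_cutoff_le y :
  1 - cutoff y ^+ 2 <= 2 * (near_zero y + near_infty y).
Proof.
have := one_sub_cutoff_le y; have := sqr_ge0 (1 - cutoff y).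
have -> : 1 - cutoff y ^+ 2 = 2 * (1 - cutoff y) - (1 - cutoff y) ^+ 2 by ring.
lra.
Qed.

(** The factor [y] comes from the weight.  It compensates the steepness of the
    cutoff, as [y * cutoff' y] is the derivative in the variable [ln y]. *)
Lemma id_cutoff' y : y * cutoff' y = (1 - near_zero y) *
  (2 * near_zero y * (1 + near_infty y)^-1
   - (2 * K)%:R * near_infty y * (1 + near_infty y)^-1 ^+ 2).
Proof.
rewrite /cutoff' mulrA; congr (_ * _).
by rewrite /near_zero; field; rewrite gt_eqF.
Qed.

Let far_le y : near_infty y * (1 + near_infty y)^-1 <= 1.
Proof. by rewrite ler_pdivrMr// mul1r lerDr. Qed.

Lemma sqr_id_cutoff'_le y :
  (y * cutoff' y) ^+ 2 <= 8 * near_zero y + 8 * K%:R ^+ 2 * near_infty y.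
Proof.
rewrite id_cutoff' natrM.
have := near_zero_ge0 y; have := near_infty_ge0 y; have := near_zero_le1 y.
have := i_ge0 y; have := i_le1 y; have := far_le y.
move: (near_zero y) (near_infty y) ((1 + near_infty y)^-1) => w z i.
move=> zi i1 i0 w1 z0 w0.
have K0 : 0 <= K%:R :> R by [].
pose A := 2 * w * i; pose B := 2 * K%:R * z * i ^+ 2.
have -> : (1 - w) * (2 * w * i - 2 * K%:R * z * i ^+ 2) =
  (1 - w) * (A - B) by [].
have AB : (A - B) ^+ 2 <= 2 * A ^+ 2 + 2 * B ^+ 2.
  by have := sqr_ge0 (A + B); rewrite !expr2; nra.
have w2 : (1 - w) ^+ 2 <= 1 by rewrite expr_le1// ?subr_ge0// lerBlDr lerDl.
have wi : (w * i) ^+ 2 <= w.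
  have : w * i <= w by rewrite ler_piMr.
  by have : 0 <= w * i by [exact: mulr_ge0]; rewrite expr2 => *; nra.
have zz : (z * i ^+ 2) ^+ 2 <= z.
  have -> : (z * i ^+ 2) ^+ 2 = z * ((z * i) * (i ^+ 3)) by ring.
  rewrite ler_piMr// mulr_ile1// ?mulr_ge0// ?exprn_ge0//.
  by rewrite exprn_ile1.
rewrite exprMn (@le_trans _ _ ((A - B) ^+ 2))//.
  by rewrite ler_piMl// sqr_ge0.
apply: (le_trans AB).
have -> : A ^+ 2 = 4 * (w * i) ^+ 2 by rewrite /A; ring.
have -> : B ^+ 2 = 4 * K%:R ^+ 2 * (z * i ^+ 2) ^+ 2 by rewrite /B; ring.
have : K%:R ^+ 2 * (z * i ^+ 2) ^+ 2 <= K%:R ^+ 2 * z.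
  by rewrite ler_wpM2l// sqr_ge0.
by move: ((z * i ^+ 2) ^+ 2) (K%:R ^+ 2 : R) zz => X Y *; nra.
Qed.

(** Either [q * y ^+ 2 <= 1], or the denominator [1 + (q * y ^+ 2) ^+ K]
    exceeds [q * y ^+ 2]. *)
Lemma sqr_cutoff_le y q : 0 < q -> c = q ^+ K -> y ^+ 2 * cutoff y ^+ 2 <= q^-1.
Proof.
move=> q0 cE.
have zE : near_infty y = (q * y ^+ 2) ^+ K.
  by rewrite /near_infty cE exprMn exprM.
set t := q * y ^+ 2 in zE.
have t0 : 0 <= t by rewrite mulr_ge0 ?sqr_ge0// ltW.
have tz : t <= 1 + near_infty y.
  rewrite zE; have [t1|t1] := leP t 1; first by rewrite ler_wpDr// exprn_ge0.
  by rewrite ler_wpDl// exprS ler_peMr// exprn_ege1// ltW.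
have -> : y ^+ 2 = q^-1 * t by rewrite mulKf// gt_eqF.
rewrite -mulrA ler_piMr ?invr_ge0 ?(ltW q0)//.
have ti : t * (1 + near_infty y)^-1 <= 1 by rewrite ler_pdivrMr// mul1r.
apply: (le_trans _ ti); rewrite ler_wpM2l//.
apply: (@le_trans _ _ (cutoff y)).
  by rewrite expr2 ler_piMr// ?cutoff_ge0 ?cutoff_le1.
by rewrite ler_piMl// lerBlDr lerDl near_zero_ge0.
Qed.

Lemma near_zero_continuous : continuous near_zero.
Proof.
apply: continuous_mul; first by move=> x; exact: cvg_cst.
apply: continuous_inv => [x|]; first by rewrite gt_eqF// d0.
by apply: continuous_add; [move=> x; exact: cvg_cst|exact: exprn_continuous].
Qed.

Lemma near_infty_continuous : continuous near_infty.
Proof. exact: continuous_pow. Qed.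

Lemma test_function_cutoff : test_function cutoff cutoff'.
Proof.
have dn (y : R) := is_derive_addc e (is_derive_expr 2 y).
have dz (y : R) := is_derive_addc 1 (is_derive_pow c (2 * K) y).
have sV1 : smooth_stable (fun y : R => (e + y ^+ 2)^-1).
  apply: smooth_stableV => [x|]; first by rewrite gt_eqF// d0.
  by apply: smooth_stableD; [exact: smooth_stable_cst|exact: smooth_stableX].
have cV1 : continuous (fun y : R => (e + y ^+ 2)^-1).
  apply: continuous_inv => [x|]; first by rewrite gt_eqF// d0.
  by apply: continuous_add; [move=> x; exact: cvg_cst|exact: exprn_continuous].
have cV2 : continuous (fun y : R => (1 + near_infty y)^-1).
  apply: continuous_inv => [x|]; first by rewrite gt_eqF.
  by apply: continuous_add; [move=> x; exact: cvg_cst|exact: continuous_pow].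
have ccst (b : R) : continuous (fun _ : R => b) by move=> x; exact: cvg_cst.
split.
- apply: smooth_stableM.
    rewrite (_ : (fun x => _) = (fun x : R => 1 + (- e) * (e + x ^+ 2)^-1)).
      apply: smooth_stableD; first exact: smooth_stable_cst.
      by apply: smooth_stableM => //; exact: smooth_stable_cst.
    by apply/funext => x; rewrite mulNr.
  apply: smooth_stableV => [x|]; first by rewrite gt_eqF.
  apply: smooth_stableD; first exact: smooth_stable_cst.
  by apply: smooth_stableM; [exact: smooth_stable_cst|exact: smooth_stableX].
- by rewrite /cutoff /near_zero expr0n/= addr0 divff ?gt_eqF// subrr mul0r.
- move=> y.
  have dw := is_derive_inv (f := fun y => e + y ^+ 2) (lt0r_neq0 (d0 y)) (dn y).
  have dw' := is_derive_addc 1 (is_derive_mul (is_derive_cst (- e) y 1) dw).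
  have dzV := is_derive_inv (f := fun y => 1 + c * y ^+ (2 * K))
    (lt0r_neq0 (z1 y)) (dz y).
  have := is_derive_mul dw' dzV.
  rewrite (_ : (fun x => _) = cutoff); last first.
    by apply/funext => x; rewrite /cutoff /near_zero /near_infty/= mulNr.
  move=> H; apply: is_derive_eq H _.
  rewrite /= mul0r addr0 /cutoff' /near_zero /near_infty.
  have -> : c * y ^+ (2 * K) = c * (y * y ^+ (2 * K).-1) by rewrite -exprS.
  move: (z1 y); rewrite /near_infty.
  have -> : c * y ^+ (2 * K) = c * (y * y ^+ (2 * K).-1) by rewrite -exprS.
  move: (y ^+ _.-1) => Y z1y.
  by field; rewrite !gt_eqF.
- apply: continuous_mul; first by apply: continuous_mul => // x; exact: cvg_id.
  rewrite (_ : (fun x => _) = (fun y => 2 * near_zero y * (1 + near_infty y)^-1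
   + (- (2 * K)%:R) * near_infty y * (1 + near_infty y)^-1 ^+ 2)); last first.
    by apply/funext => x; rewrite !mulNr.
  apply: continuous_add.
    apply: continuous_mul => //; apply: continuous_mul => //.
    exact: continuous_mul.
  apply: continuous_mul; last exact: continuous_mul.
  by apply: continuous_mul => //; exact: continuous_pow.
- exists ((1 + e^-1) * (2 + (2 * K)%:R)).
    by rewrite mulr_gt0// ltr_pwDl// ?invr_ge0 ?ltW.
  have ie : 0 < e^-1 by rewrite invr_gt0.
  have twoK : 0 <= (2 * K)%:R :> R by [].
  move=> y; split.
    rewrite ger0_norm ?cutoff_ge0// (le_trans (cutoff_le1 y))//.
    by rewrite mulr_ege1// ?lerDl ?ltW//; lra.
  rewrite /cutoff' normrM ler_pM//.
    rewrite normrM normfV [X in _ / X]gtr0_norm// ler_pdivrMr//.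
    rewrite mulrDl mul1r mulrDr mulVf ?gt_eqF//.
    have : 0 <= e^-1 * y ^+ 2 by rewrite mulr_ge0 ?sqr_ge0// ltW.
    rewrite -[y ^+ 2]real_normK ?num_real//.
    move: (_ * `|y| ^+ 2) => p p0.
    by have := sqr_ge0 (`|y| - 2^-1); rewrite expr2; have := ltW e0; lra.
  have := near_zero_ge0 y; have := near_infty_ge0 y; have := near_zero_le1 y.
  have := i_ge0 y; have := i_le1 y; have := far_le y.
  move: (near_zero y) (near_infty y) ((1 + near_infty y)^-1) => w z i.
  move=> zi i1 i0 w1 z0 w0.
  rewrite (le_trans (ler_normB _ _))// lerD//.
    rewrite ger0_norm ?mulr_ge0// -mulrA ler_piMr// mulr_ile1//.
  rewrite ger0_norm ?mulr_ge0 ?exprn_ge0// -!mulrA ler_piMr//.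
  by rewrite expr2 mulrA mulr_ile1// mulr_ge0.
Qed.

End Cutoff.

(** * Entropy and exponential moments *)

Section RealEntropy.
Context (R : realType).
Implicit Types p q P Q L x : R.

Lemma ln_le_sub1 x : 0 < x -> ln x <= x - 1.
Proof.
move=> x0; have -> : ln x = ln (1 + (x - 1)) by rewrite addrC subrK.
by apply: le_ln1Dx; rewrite ltrBDr addrC subrr.
Qed.

(** When [P = 0] the quotient and its logarithm are 0, hence so is the bounded
    quantity; this makes the entropy finite with no case distinction on the
    mean. *)
Lemma norm_xlnx_le x P L : 0 <= x <= L -> 0 <= P ->
  `|x * ln (x / P)| <= P + L ^+ 2 / P.
Proof.
move=> /andP[x0 xL]; rewrite le_eqVlt => /orP[/eqP <-|P0].
  by rewrite invr0 !mulr0 ln0// mulr0 normr0 addr0.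
have L0 : 0 <= L := le_trans x0 xL.
have LP : 0 <= L ^+ 2 / P by rewrite divr_ge0 ?sqr_ge0// ltW.
move: x0; rewrite le_eqVlt => /orP[/eqP <-|x0].
  by rewrite mul0r normr0 addr_ge0// ltW.
have xP0 : 0 < x / P by rewrite divr_gt0.
rewrite ler_norml; apply/andP; split.
  have := ln_le_sub1 (x := P / x); rewrite divr_gt0// => /(_ isT) h.
  have lnE : ln (x / P) = - ln (P / x).
    by rewrite -lnV ?posrE ?divr_gt0// invf_div.
  rewrite lnE mulrN lerN2.
  apply: (@le_trans _ _ (x * (P / x - 1))); first by rewrite ler_pM2l.
  have -> : x * (P / x - 1) = P - x by field; rewrite gt_eqF.
  by apply: lerD => //; rewrite (le_trans _ LP)// oppr_le0 ltW.
apply: (@le_trans _ _ (x * (x / P - 1))).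
  by rewrite ler_pM2l// ln_le_sub1.
rewrite ler_wpDl ?(ltW P0)//.
apply: (@le_trans _ _ (x * (x / P))); first by rewrite ler_pM2l// gerBl.
by rewrite mulrA -expr2 ler_pM2r ?invr_gt0// lerXn2r// nnegrE ltW.
Qed.

(** The tangent of [x ln x] at [p] bounds [p ln p - q ln q] by
    [(p - q) * (1 + ln L)]; the remaining terms renormalize by the means. *)
Lemma xlnx_diff_le p q P Q L : 0 <= q -> q <= p -> p <= L ->
  (0 < p -> 0 < P) -> (0 < q -> 0 < Q) ->
  p * ln (p / P) <= q * ln (q / Q) +
    (q * (ln Q - (1 + ln L)) + p * (1 + ln L - ln P)).
Proof.
move=> q0 qp pL pP qQ.
have [p0|p0] := leP p 0.
  have -> : p = 0 by apply/eqP; rewrite eq_le p0 (le_trans q0).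
  have -> : q = 0 by apply/eqP; rewrite eq_le q0 (le_trans qp).
  by rewrite !mul0r !addr0.
have P0 := pP p0.
have lnpL : ln p <= ln L by rewrite ler_ln ?posrE// (lt_le_trans p0).
rewrite ln_div ?posrE//.
have [q00|q00] := leP q 0.
  have -> : q = 0 by apply/eqP; rewrite eq_le q00.
  rewrite !mul0r !add0r ler_pM2l//; lra.
have Q0 := qQ q00.
rewrite ln_div ?posrE//.
have h : q * (ln p - ln q) <= p - q.
  have := ln_le_sub1 (divr_gt0 p0 q00); rewrite ln_div ?posrE// => h.
  have -> : p - q = q * (p / q - 1) by field; rewrite gt_eqF.
  by rewrite ler_pM2l.
have : (p - q) * ln p <= (p - q) * ln L by rewrite ler_wpM2l// subr_ge0.
lra.
Qed.

(** [x ln x] is superadditive, so the left-hand side is at most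
    [d * (1 + ln (L / d))] with [d = P - Q]; finally
    [ln (L / d) = 2 * ln (sqrt (L / d))] and [ln r <= r - 1]. *)
Lemma xlnx_mean_le P Q L : 0 < L -> 0 <= Q -> Q <= P ->
  Q * (ln Q - (1 + ln L)) + P * (1 + ln L - ln P) <= 2 * Num.sqrt ((P - Q) * L).
Proof.
move=> L0 Q0 QP.
have [PQ|PQ] := leP P Q.
  have -> : P = Q by apply/eqP; rewrite eq_le PQ QP.
  rewrite [X in X <= _](_ : _ = 0); last by ring.
  by rewrite mulr_ge0// sqrtr_ge0.
have d0 : 0 < P - Q by rewrite subr_gt0.
have P0 : 0 < P := le_lt_trans Q0 PQ.
have lnd : ln (P - Q) <= ln P by rewrite ler_ln ?posrE// gerBl.
have QlnQ : Q * ln Q <= Q * ln P.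
  move: Q0; rewrite le_eqVlt => /orP[/eqP <-|Q0']; first by rewrite !mul0r.
  by rewrite ler_pM2l// ler_ln ?posrE.
have dlnd : (P - Q) * ln (P - Q) <= (P - Q) * ln P by rewrite ler_pM2l.
set s := Num.sqrt _.
have s0 : 0 < s by rewrite sqrtr_gt0 mulr_gt0.
have s2 : s ^+ 2 = (P - Q) * L by rewrite sqr_sqrtr// mulr_ge0// ltW.
have h := ln_le_sub1 (divr_gt0 s0 d0).
have lnE : ln L - ln (P - Q) = 2 * ln (s / (P - Q)).
  have -> : 2 * ln (s / (P - Q)) = ln ((s / (P - Q)) ^+ 2).
    by rewrite lnXn ?divr_gt0// mulr_natl.
  rewrite exprMn s2 -ln_div ?posrE//; congr ln; field; rewrite gt_eqF//.
have : (P - Q) * (ln L - ln (P - Q)) <= 2 * s - 2 * (P - Q).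
  rewrite lnE.
  have -> : 2 * s - 2 * (P - Q) = (P - Q) * (2 * (s / (P - Q) - 1)).
    by field; rewrite gt_eqF.
  by rewrite ler_pM2l// ler_pM2l.
lra.
Qed.

End RealEntropy.

Section Entropy.
Context d (X : measurableType d) (R : realType) (mu : probability X R).
Implicit Types p q v : X -> R.

Lemma integrable_ae_bounded v (B : R) : measurable_fun setT v ->
  {ae mu, forall x, `|v x| <= B} -> mu.-integrable setT (EFin \o v).
Proof.
move=> mv vB; apply/integrableP; split; first exact/measurable_EFinP.
have B0 : 0 <= Num.max B 0 by rewrite le_max lexx orbT.
apply: (@le_lt_trans _ _ (\int[mu]_x (Num.max B 0)%:E)%E); last first.
  by rewrite integral_cst// [X in (_ * X)%E]probability_setT mule1 ltry.
apply: ae_ge0_le_integral => //.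
- by apply: measurableT_comp => //; exact/measurable_EFinP.
- by apply: filterS vB => x vx _; rewrite /= lee_fin le_max vx.
Qed.

Lemma ae_le_integral v w :
  mu.-integrable setT (EFin \o v) -> mu.-integrable setT (EFin \o w) ->
  {ae mu, forall x, v x <= w x} ->
  (\int[mu]_x (v x)%:E <= \int[mu]_x (w x)%:E)%E.
Proof.
move=> iv iw vw.
have /measurable_EFinP mv := measurable_int _ iv.
have /measurable_EFinP mw := measurable_int _ iw.
have mm : measurable_fun setT (fun x => Num.max (v x) (w x)).
  exact: measurable_maxr.
have -> : (\int[mu]_x (w x)%:E = \int[mu]_x (Num.max (v x) (w x))%:E)%E.
  apply: ae_eq_integral => //; try exact/measurable_EFinP.
  by apply: filterS vw => x vx _; rewrite max_r.
apply: le_integral => //.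
  apply: le_integrable
    (integrableD measurableT (integrable_abse iv) (integrable_abse iw)) => //.
    exact/measurable_EFinP.
  move=> x _ /=; rewrite lee_fin [leRHS]ger0_norm ?addr_ge0//.
  by case: (leP (v x) (w x)) => _; [rewrite lerDr|rewrite lerDl].
by move=> x _; rewrite lee_fin le_max lexx.
Qed.

Lemma integral_EFin v : mu.-integrable setT (EFin \o v) ->
  (\int[mu]_x (v x)%:E)%E = (\int[mu]_x v x)%R%:E.
Proof. by move=> iv; rewrite /Rintegral fineK//; exact: integrable_fin_num. Qed.

Lemma ae_le_Rintegral v w :
  mu.-integrable setT (EFin \o v) -> mu.-integrable setT (EFin \o w) ->
  {ae mu, forall x, v x <= w x} -> \int[mu]_x v x <= \int[mu]_x w x.
Proof.
by move=> iv iw vw; rewrite -lee_fin -!integral_EFin//; exact: ae_le_integral.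
Qed.

Lemma ae_Rintegral_ge0 v : mu.-integrable setT (EFin \o v) ->
  {ae mu, forall x, 0 <= v x} -> 0 <= \int[mu]_x v x.
Proof.
move=> iv v0; rewrite -lee_fin -integral_EFin//.
have := @ae_le_integral (cst 0) v (integrable0 mu setT) iv v0.
by rewrite integral0.
Qed.

Lemma Rintegral_gt0 v : mu.-integrable setT (EFin \o v) ->
  {ae mu, forall x, 0 <= v x} ->
  {ae mu, forall x, 0 < v x -> 0 < \int[mu]_x v x}.
Proof.
move=> iv v0; have := ae_Rintegral_ge0 iv v0.
rewrite le_eqVlt => /orP[/eqP I0|I0]; last by apply: nearW.
have /measurable_EFinP mv := measurable_int _ iv.
have : (\int[mu]_x `|(v x)%:E| = 0)%E.
  rewrite -[RHS](_ : \int[mu]_x (v x)%:E = 0)%E; last first.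
    by rewrite integral_EFin// -I0.
  apply: ae_eq_integral => //.
  - by apply: measurableT_comp => //; exact/measurable_EFinP.
  - exact/measurable_EFinP.
  - by apply: filterS v0 => x vx _; rewrite gee0_abs.
move/ae_eq_integral_abs => /(_ measurableT).
have mv' : measurable_fun setT (fun x => (v x)%:E) by exact/measurable_EFinP.
move=> /(_ mv'); apply: filterS => x /(_ I) [->].
by rewrite ltxx.
Qed.

Lemma entropy_integrable p (L : R) : measurable_fun setT p ->
  {ae mu, forall x, 0 <= p x <= L} ->
  mu.-integrable setT (EFin \o (fun x => p x * ln (p x / \int[mu]_y p y))).
Proof.
move=> mp pL.
have ip : mu.-integrable setT (EFin \o p).
  apply: (@integrable_ae_bounded _ L) => //.
  apply: filterS pL => x /andP[p0 pL].
  by rewrite ger0_norm.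
have P0 : 0 <= \int[mu]_y p y.
  by apply: ae_Rintegral_ge0 => //; apply: filterS pL => x /andP[].
set P := \int[mu]_y p y in P0 *.
apply: (@integrable_ae_bounded _ (P + L ^+ 2 / P)).
  apply: measurable_funM => //.
  apply: measurableT_comp; first exact: measurable_ln.
  by apply: measurable_funM => //; exact: measurable_cst.
by apply: filterS pL => x px; exact: norm_xlnx_le.
Qed.

(** The logarithmic loss in the mean is harmless: it is absorbed by the square
    root, so that an exponentially small loss of mass costs an exponentially
    small amount of entropy. *)
Lemma entropy_le p q (L : R) : 0 < L ->
  measurable_fun setT p -> measurable_fun setT q ->
  {ae mu, forall x, [/\ 0 <= q x, q x <= p x & p x <= L]} ->
  (entropy mu p <= entropy mu q +
    (2 * Num.sqrt ((\int[mu]_x p x - \int[mu]_x q x) * L))%:E)%E.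
Proof.
move=> L0 mp mq qpL.
have pL : {ae mu, forall x, 0 <= p x <= L}.
  by apply: filterS qpL => x [q0 qp ->]; rewrite (le_trans q0).
have qL : {ae mu, forall x, 0 <= q x <= L}.
  by apply: filterS qpL => x [-> qp pL']; rewrite (le_trans qp).
have ib v : measurable_fun setT v -> {ae mu, forall x, 0 <= v x <= L} ->
    mu.-integrable setT (EFin \o v).
  move=> mv vL; apply: (@integrable_ae_bounded _ L) => //.
  by apply: filterS vL => x /andP[p0 pL']; rewrite ger0_norm.
have ip := ib _ mp pL; have iq := ib _ mq qL.
have ep := entropy_integrable mp pL; have eq_ := entropy_integrable mq qL.
have p0 : {ae mu, forall x, 0 <= p x} by apply: filterS pL => x /andP[].
have q0 : {ae mu, forall x, 0 <= q x} by apply: filterS qL => x /andP[].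
have QP : \int[mu]_x q x <= \int[mu]_x p x.
  by apply: ae_le_Rintegral => //; apply: filterS qpL => x [].
have Q0 := ae_Rintegral_ge0 iq q0.
have Ppos := Rintegral_gt0 ip p0; have Qpos := Rintegral_gt0 iq q0.
rewrite /entropy.
set P := \int[mu]_x p x in QP Ppos ep *.
set Q := \int[mu]_x q x in QP Q0 Qpos eq_ *.
have ir : mu.-integrable setT (EFin \o (fun x =>
    q x * (ln Q - (1 + ln L)) + p x * (1 + ln L - ln P))).
  rewrite (_ : EFin \o _ = (fun x => (q x)%:E * (ln Q - (1 + ln L))%:E +
      (p x)%:E * (1 + ln L - ln P)%:E)%E).
    by apply: integrableD => //; exact: integrableZr.
  by apply/funext => x /=.
apply: (@le_trans _ _ (\int[mu]_x ((q x * ln (q x / Q) +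
    (q x * (ln Q - (1 + ln L)) + p x * (1 + ln L - ln P))))%:E)%E).
  apply: ae_le_integral => //.
    rewrite (_ : EFin \o _ = (fun x => (q x * ln (q x / Q))%:E +
      (q x * (ln Q - (1 + ln L)) + p x * (1 + ln L - ln P))%:E)%E).
      exact: integrableD.
    by apply/funext => x /=.
  apply: filterS3 qpL Ppos Qpos => x [q0x qpx pLx] Px Qx.
  exact: xlnx_diff_le.
under eq_integral do rewrite EFinD.
rewrite integralD//; apply: leeD => //.
rewrite (_ : (\int[mu]_x _ =
    (Q * (ln Q - (1 + ln L)) + P * (1 + ln L - ln P))%:E)%E).
  by rewrite lee_fin; exact: xlnx_mean_le.
under eq_integral do rewrite EFinD !EFinM.
rewrite integralD//; [|exact: integrableZr|exact: integrableZr].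
rewrite !integralZr// !integral_EFin//.
Qed.

Lemma eq_ae_entropy p q : measurable_fun setT p -> measurable_fun setT q ->
  {ae mu, forall x, p x = q x} -> entropy mu p = entropy mu q.
Proof.
move=> mp mq pq.
have PQ : \int[mu]_x p x = \int[mu]_x q x.
  congr fine; apply: ae_eq_integral => //; try exact/measurable_EFinP.
  by apply: filterS pq => x -> _.
rewrite /entropy PQ.
have ml v : measurable_fun setT v ->
    measurable_fun setT (fun x => (v x * ln (v x / \int[mu]_x q x))%:E).
  move=> mv; apply/measurable_EFinP.
  apply: measurable_funM => //.
  apply: measurableT_comp; first exact: measurable_ln.
  by apply: measurable_funM => //; exact: measurable_cst.
apply: ae_eq_integral => //; try exact: ml.
by apply: filterS pq => x -> _.
Qed.

End Entropy.

Section Moments.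
Context d (X : measurableType d) (R : realType) (mu : probability X R).
Context (u : X -> R).
Hypothesis mu_ : measurable_fun setT u.

(** [t ^+ K / K! <= exp t] with [t = C * y ^+ 2], and [K! <= K ^ K]. *)
Lemma near_infty_le_expR (C : R) (k : nat) (y : R) : 0 < C ->
  near_infty ((C / (8 * k.+1%:R)) ^+ k.+1) k y <=
  (8 ^+ k.+1)^-1 * expR (C * y ^+ 2).
Proof.
move=> C0; rewrite /near_infty exprM -exprMn.
have : 0 <= C * y ^+ 2 by rewrite mulr_ge0 ?sqr_ge0// ltW.
have -> : C / (8 * k.+1%:R) * y ^+ 2 = 8^-1 * (k.+1%:R^-1 * (C * y ^+ 2)).
  have K0 : k.+1%:R != 0 :> R by rewrite pnatr_eq0.
  by move: (k.+1%:R) K0 => j j0; field.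
move: (C * y ^+ 2) => t t0.
rewrite !exprMn [8^-1 ^+ _]exprVn ler_pM2l ?invr_gt0 ?exprn_gt0//.
apply: (@le_trans _ _ (t ^+ k.+1 / (k.+1)`!%:R)).
  rewrite mulrC ler_wpM2l ?exprn_ge0// exprVn -natrX.
  rewrite lef_pV2 ?posrE ?ltr0n ?expn_gt0 ?fact_gt0//.
  rewrite ler_nat; elim: k.+1 => // j IH.
  rewrite factS expnS leq_mul2l/= (leq_trans IH)//.
  by case: j {IH} => // j; rewrite leq_exp2r.
by apply: (le_trans _ (expR_ge1Dxn k t0)); rewrite lerDr.
Qed.

Lemma near_zero_integral_small (dl : R) :
  0 < dl -> {ae mu, forall x, 0 < u x} ->
  exists2 e : R, 0 < e & (\int[mu]_x (near_zero e (u x))%:E <= dl%:E)%E.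
Proof.
move=> dl0 u0.
pose e (m : nat) : R := m.+1%:R^-1.
have e0 m : 0 < e m by rewrite invr_gt0.
have mz m : measurable_fun setT (fun x => near_zero (e m) (u x)).
  apply: measurableT_comp mu_; apply: continuous_measurable_fun.
  exact: near_zero_continuous.
have cv : {ae mu, forall x, setT x ->
    (near_zero (e m) (u x))%:E @[m --> \oo] --> (cst 0%E : X -> \bar R) x}.
  apply: filterS u0 => x ux _.
  apply: cvg_EFin; first exact: nearW.
  have eh : e @ \oo --> 0 by exact: cvg_harmonic.
  rewrite /near_zero -[X in _ --> X](mul0r (0 + u x ^+ 2)^-1).
  apply: (cvgM eh _); apply: cvgV; first by rewrite add0r sqrf_eq0 gt_eqF.
  by apply: (cvgD eh _); exact: cvg_cst.
have bd : {ae mu, forall x m, setT x ->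
    (`|(near_zero (e m) (u x))%:E| <= (cst 1%E : X -> \bar R) x)%E}.
  apply: nearW => x m _.
  by rewrite lee_fin ger0_norm ?near_zero_ge0 ?near_zero_le1.
have i1 : mu.-integrable setT (cst 1%E : X -> \bar R).
  apply: (@integrable_ae_bounded _ _ _ mu (cst 1) 1).
    exact: measurable_cst.
  by apply: nearW => x; rewrite normr1.
have [_ _] := @dominated_convergence _ _ _ mu setT measurableT
  (fun m x => (near_zero (e m) (u x))%:E) (cst 0%E) (cst 1%E)
  (fun m => (measurable_EFinP _ _).2 (mz m)) (measurable_cst _) cv i1 bd.
rewrite integral0 => h.
near \oo => m; exists (e m) => //; apply: ltW; near: m.
apply: (h [set y | (y < dl%:E)%E]).
apply: open_nbhs_nbhs; split; first exact: open_ereal_lt_ereal.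
by rewrite /= lte_fin.
Unshelve. all: by end_near. Qed.

End Moments.

(** * From the weighted to the weak logarithmic Sobolev inequality *)

Lemma pow_bounds (R : realType) (k : nat) :
  [/\ (8 ^+ k.+1)^-1 <= 2^-1 ^+ k.+1 :> R,
      k.+1%:R ^+ 2 * (8 ^+ k.+1)^-1 <= 2^-1 ^+ k.+1 :> R &
      (8 ^+ k.+1)^-1 <= (2^-1 ^+ k.+1) ^+ 2 :> R].
Proof.
have h0 : 0 <= 2^-1 :> R by rewrite invr_ge0.
have h1 : 2^-1 <= 1 :> R by rewrite invf_le1// ler1n.
have -> : (8 ^+ k.+1)^-1 = 2^-1 ^+ k.+1 * (2^-1 ^+ k.+1 * 2^-1 ^+ k.+1) :> R.
  by rewrite -!exprMn -exprVn; congr (_ ^+ _); field.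
set h := 2^-1 ^+ k.+1.
have hh : 0 <= h by rewrite exprn_ge0.
have hh1 : h <= 1 by rewrite exprn_ile1.
have kh : k.+1%:R * h <= 1.
  rewrite /h exprVn ler_pdivrMr ?exprn_gt0// mul1r -natrX ler_nat ltnW//.
  by rewrite ltn_expl.
split.
- by rewrite ler_piMr// mulr_ile1.
- have -> : k.+1%:R ^+ 2 * (h * (h * h)) =
    h * ((k.+1%:R * h) * (k.+1%:R * h)) by ring.
  by rewrite ler_piMr// mulr_ile1// mulr_ge0.
- by rewrite expr2 ler_wpM2l// ler_piMl.
Qed.

Section MassDefect.
Context d (X : measurableType d) (R : realType) (mu : probability X R).
Context (f u : X -> R) (l e c N : R) (k : nat).
Hypotheses (l0 : 0 < l) (e0 : 0 < e) (c0 : 0 < c).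
Hypotheses (mf : measurable_fun setT f) (mu_ : measurable_fun setT u).
Hypothesis fN : {ae mu, forall x, `|f x| <= N}.

Let v x := trunc l (f x) * cutoff e c k (u x).

Lemma sqr_cut_le x : v x ^+ 2 <= f x ^+ 2.
Proof.
rewrite -[f x ^+ 2]real_normK ?num_real// le_sqr_norm// normrM.
rewrite (le_trans _ (trunc_le l0 (f x)))// ler_piMr//.
by rewrite ger0_norm ?cutoff_ge0// cutoff_le1.
Qed.

Lemma sqr_cut_defect_le x : `|f x| <= N ->
  f x ^+ 2 <= v x ^+ 2 + (2 * l * N ^+ 4 +
    2 * N ^+ 2 * (near_zero e (u x) + near_infty c k (u x))).
Proof.
move=> fx; have h1 := sqr_sub_trunc_le l0 fx.
have h2 := one_sub_sqr_cutoff_le k e0 c0 (u x).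
have t0 := le_trans (trunc_le l0 (f x)) fx.
have h3 := le_sqr_norm t0.
have := near_zero_ge0 e0 (u x); have := near_infty_ge0 k c0 (u x).
rewrite /v exprMn; move: h2 => /[swap] z0 /[swap] w0.
move: (near_zero _ _ + _) (addr_ge0 w0 z0) => b b0 h2.
have : trunc l (f x) ^+ 2 * (1 - cutoff e c k (u x) ^+ 2) <= N ^+ 2 * (2 * b).
  apply: (le_trans (ler_wpM2l (sqr_ge0 _) h2)).
  by rewrite ler_wpM2r// mulr_ge0.
move: (trunc _ _ ^+ 2) (cutoff _ _ _ _ ^+ 2) (f x ^+ 2) h1 => p t f2 h1.
lra.
Qed.

Hypothesis iz : mu.-integrable setT (EFin \o (fun x => near_infty c k (u x))).

Lemma mass_defect_le : \int[mu]_x f x ^+ 2 - \int[mu]_x v x ^+ 2 <=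
  2 * l * N ^+ 4 + 2 * N ^+ 2 *
    (\int[mu]_x near_zero e (u x) + \int[mu]_x near_infty c k (u x)).
Proof.
have mcomp (h : R -> R) (y : X -> R) : continuous h -> measurable_fun setT y ->
    measurable_fun setT (h \o y).
  by move=> ch my; apply: measurableT_comp my; exact: continuous_measurable_fun.
have mv : measurable_fun setT v.
  apply: measurable_funM; apply: mcomp => //.
    exact: test_function_continuous (test_function_trunc l0).
  exact: test_function_continuous (test_function_cutoff k e0 c0).
have iw : mu.-integrable setT (EFin \o (fun x => near_zero e (u x))).
  apply: (@integrable_ae_bounded _ _ _ mu _ 1).
    exact: mcomp (near_zero_continuous e0) mu_.
  by apply: nearW => x; rewrite ger0_norm ?near_zero_le1 ?near_zero_ge0.
have if2 : mu.-integrable setT (EFin \o (fun x => f x ^+ 2)).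
  apply: (@integrable_ae_bounded _ _ _ mu _ (N ^+ 2)).
    exact: measurable_funX.
  by apply: filterS fN => x fx; rewrite ger0_norm ?sqr_ge0// le_sqr_norm.
have iv2 : mu.-integrable setT (EFin \o (fun x => v x ^+ 2)).
  apply: (@integrable_ae_bounded _ _ _ mu _ (N ^+ 2)).
    exact: measurable_funX.
  apply: filterS fN => x fx; rewrite ger0_norm ?sqr_ge0//.
  by rewrite (le_trans (sqr_cut_le x))// le_sqr_norm.
have iD (y y' : X -> R) : mu.-integrable setT (EFin \o y) ->
    mu.-integrable setT (EFin \o y') ->
    mu.-integrable setT (EFin \o (fun x => y x + y' x)).
  move=> iy iy'; rewrite (_ : EFin \o _ = (EFin \o y) \+ (EFin \o y'))%E//.
  exact: integrableD.
have iwz := iD _ _ iw iz.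
have i2 : mu.-integrable setT (EFin \o (fun x => 2 * N ^+ 2 *
    (near_zero e (u x) + near_infty c k (u x)))).
  rewrite (_ : EFin \o _ = (fun x => (2 * N ^+ 2)%:E *
      (EFin \o (fun x => near_zero e (u x) + near_infty c k (u x))%R) x)%E)//.
  exact: integrableZl.
have ic : mu.-integrable setT (EFin \o (fun _ : X => 2 * l * N ^+ 4)).
  apply: (@integrable_ae_bounded _ _ _ mu _ `|2 * l * N ^+ 4|).
    exact: measurable_cst.
  exact: nearW.
rewrite lerBlDl.
apply: (le_trans (ae_le_Rintegral if2 (iD _ _ iv2 (iD _ _ ic i2)) _)).
  by apply: filterS fN => x; exact: sqr_cut_defect_le.
rewrite !RintegralD//; last exact: iD.
rewrite Rintegral_cst// [fine _](_ : _ = 1); last first.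
  by rewrite [X in fine X]probability_setT.
by rewrite mulr1 RintegralZl// RintegralD.
Qed.

End MassDefect.

Section WeakLogSobolev.
Context (R : realType) (n : nat) (M : metricType R) (S : smooth_structure n M).
Context (g : riemannian_metric S) (T : R) (x0 : M).
Context (mu : probability (path_space T x0) R).
Context (par : path_space T x0 -> R -> 'M[R]_n).

Local Notation nrm2 := (cm_norm2 g T x0).
Local Notation energy G := (\int[mu]_sigma nrm2 (G sigma))%E.

Lemma bounded_finite_norm (v : path_space T x0 -> R) (b : R) :
  (forall x, `|v x| <= b) -> finite_norm mu +oo v.
Proof.
move=> vb; rewrite /finite_norm unlock.
case: ifPn => _; last exact: ltry.
apply: (@le_lt_trans _ _ b%:E); last exact: ltry.
by apply/ess_supP; apply: nearW => x /=; rewrite lee_fin.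
Qed.

Lemma ae_norm_le_Lnorm (v : path_space T x0 -> R) : finite_norm mu +oo v ->
  exists2 N, 0 <= N & ('N[mu]_+oo[EFin \o v] = N%:E)%E /\
    {ae mu, forall x, `|v x| <= N}.
Proof.
rewrite /finite_norm => vfin.
have v0 := Lnorm_ge0 mu +oo%E (EFin \o v).
exists (fine 'N[mu]_+oo[EFin \o v]%E); first exact: fine_ge0.
split; first by rewrite fineK// ge0_fin_numE.
have := ess_sup_ge mu (abse \o (EFin \o v)).
have mu0 : (0 < mu [set: path_space T x0])%E.
  by rewrite [X in (_ < X)%E]probability_setT.
apply: filterS => x /=; rewrite -lee_fin fineK ?ge0_fin_numE//.
by rewrite unlock /= mu0.
Qed.

(** The weight [u ^+ 2] is absorbed twice: by [sqr_cutoff_le] in front of the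
    gradient of [f], by [sqr_id_cutoff'_le] in front of that of [u]. *)
Lemma energy_cutoff_le (f u : path_space T x0 -> R)
    (Gf Gu : path_space T x0 -> R -> 'rV[R]_n) (l e q c N a : R) (k : nat) :
  c = q ^+ k.+1 -> 0 < l -> 0 < e -> 0 < q ->
  measurable_fun setT f -> measurable_fun setT u ->
  measurable_section Gf -> measurable_section Gu ->
  {ae mu, forall x, `|f x| <= N} ->
  {ae mu, forall x, (nrm2 (Gu x) <= (a ^+ 2)%:E)%E} ->
  (\int[mu]_x ((u x ^+ 2)%:E * nrm2 (fun s =>
     ((trunc' l (f x) * cutoff e c k (u x)) *: Gf x s +
      (trunc l (f x) * cutoff' e c k (u x)) *: Gu x s)%R)) <=
   (2 * q^-1)%:E * energy Gf + (16 * N ^+ 2 * a ^+ 2)%:E *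
    (\int[mu]_x (near_zero e (u x))%:E +
     (k.+1%:R ^+ 2)%:E * \int[mu]_x (near_infty c k (u x))%:E))%E.
Proof.
move=> cE l0 e0 q0 mf mu_ mGf mGu fN Gua.
have c0 : 0 < c by rewrite cE exprn_gt0.
pose w x := near_zero e (u x); pose z x := near_infty c k (u x).
have mcomp (h : R -> R) (y : path_space T x0 -> R) : continuous h ->
    measurable_fun setT y -> measurable_fun setT (h \o y).
  by move=> ch my; apply: measurableT_comp my; exact: continuous_measurable_fun.
have pw : nonneg_mfun (fun x => (w x)%:E).
  split=> [|x]; last by rewrite lee_fin near_zero_ge0.
  apply/measurable_EFinP; apply: (mcomp (near_zero e) u) => //.
  exact: near_zero_continuous.
have pz : nonneg_mfun (fun x => (z x)%:E).
  split=> [|x]; last by rewrite lee_fin near_infty_ge0.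
  apply/measurable_EFinP; apply: (mcomp (near_infty c k) u) => //.
  exact: near_infty_continuous.
have A0 : 0 <= 16 * N ^+ 2 * a ^+ 2.
  by apply: mulr_ge0 (sqr_ge0 _); exact: mulr_ge0 (ler0n _ 16) (sqr_ge0 _).
have q2 : 0 <= 2 * q^-1 by rewrite mulr_ge0// invr_ge0 ltW.
have pZ (b : R) h : 0 <= b -> nonneg_mfun h ->
    nonneg_mfun (fun x : path_space T x0 => b%:E * h x)%E.
  by move=> b0; apply: nonneg_mfunM; exact: nonneg_mfun_cst.
have pzK := pZ _ _ (sqr_ge0 (k.+1%:R : R)) pz.
have pwz := nonneg_mfunD pw pzK.
have pG := nonneg_mfun_nrm2 g mGf.
rewrite -(integral_nonnegZ _ (sqr_ge0 _) pz) -(integral_nonnegD _ pw pzK).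
rewrite -(integral_nonnegZ _ A0 pwz) -(integral_nonnegZ _ q2 pG).
rewrite -(integral_nonnegD _ (pZ _ _ q2 pG) (pZ _ _ A0 pwz)).
apply: integral_nonneg_le.
- apply: nonneg_mfunM; first exact: nonneg_mfun_sqr.
  have [_ _ _ cphi' _] := test_function_trunc l0.
  have cphi := test_function_continuous (test_function_trunc l0).
  have [_ _ _ cth' _] := test_function_cutoff k e0 c0.
  have cth := test_function_continuous (test_function_cutoff k e0 c0).
  apply: nonneg_mfun_nrm2; apply: measurable_section_lin => //;
    by apply: measurable_funM; exact: mcomp.
- exact: nonneg_mfunD (pZ _ _ q2 pG) (pZ _ _ A0 pwz).
apply: filterS2 fN Gua => x fx Gux.
have mpf := measurable_section_path x mGf.
have mpu := measurable_section_path x mGu.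
have p2 (y : R) : (0 <= (2 * y ^+ 2)%:E)%E.
  by rewrite lee_fin; exact: mulr_ge0 (ler0n _ 2) (sqr_ge0 _).
have u20 : (0 <= (u x ^+ 2)%:E)%E by rewrite lee_fin sqr_ge0.
apply: (le_trans (lee_wpmul2l u20 (cm_norm2_lin_le g x0 _ _ mpf mpu))).
rewrite ge0_muleDr; [|exact: mule_ge0 (p2 _) (cm_norm2_ge0 _ _ _ _)..].
rewrite !muleA -!EFinM; apply: leeD.
  apply: lee_wpmul2r; first exact: cm_norm2_ge0.
  rewrite lee_fin.
  have -> : u x ^+ 2 * (2 * (trunc' l (f x) * cutoff e c k (u x)) ^+ 2) =
    2 * (trunc' l (f x) ^+ 2 * (u x ^+ 2 * cutoff e c k (u x) ^+ 2)) by ring.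
  rewrite ler_pM2l// (le_trans _ (sqr_cutoff_le e0 c0 (u x) q0 cE))//.
  apply: ler_piMl; first by apply: mulr_ge0; exact: sqr_ge0.
  by rewrite -(expr1n _ 2) le_sqr_norm//; exact: trunc'_le.
set b := u x ^+ 2 * (2 * _).
have b0 : (0 <= b%:E)%E.
  rewrite lee_fin; apply: mulr_ge0 (sqr_ge0 _) _.
  exact: mulr_ge0 (ler0n _ 2) (sqr_ge0 _).
apply: (le_trans (lee_wpmul2l b0 Gux)); rewrite -EFinM lee_fin.
have -> : b * a ^+ 2 =
  2 * a ^+ 2 * (trunc l (f x) ^+ 2 * (u x * cutoff' e c k (u x)) ^+ 2).
  by rewrite /b; ring.
have -> : 16 * N ^+ 2 * a ^+ 2 * (w x + k.+1%:R ^+ 2 * z x) =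
  2 * a ^+ 2 * (N ^+ 2 * (8 * w x + 8 * k.+1%:R ^+ 2 * z x)) by ring.
apply: ler_wpM2l; first exact: mulr_ge0 (ler0n _ 2) (sqr_ge0 _).
apply: ler_pM; [exact: sqr_ge0|exact: sqr_ge0| |].
  exact: le_sqr_norm (le_trans (trunc_le l0 _) fx).
exact: sqr_id_cutoff'_le.
Qed.

(** The inequality at the scale [K = k.+1].  The base 8 leaves room for the
    factor [K ^+ 2] and for the square root before ending with [2 ^- K]. *)
Lemma entropy_le_energy (u f : path_space T x0 -> R)
    (Gu Gf : path_space T x0 -> R -> 'rV[R]_n) (a C B N : R) (k : nat) :
  0 <= T -> 0 < C -> 0 < N ->
  sobolev_gradient g mu par u Gu -> {ae mu, forall sigma, 0 < u sigma} ->
  (forall v Gv, sobolev_gradient g mu par v Gv -> finite_norm mu +oo v ->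
     (entropy mu (fun sigma => (v sigma) ^+ 2)%R <=
      \int[mu]_sigma (((u sigma) ^+ 2)%:E * nrm2 (Gv sigma)))%E) ->
  {ae mu, forall sigma, (nrm2 (Gu sigma) <= (a ^+ 2)%:E)%E} ->
  (\int[mu]_sigma (expR (C * (u sigma) ^+ 2))%:E <= B%:E)%E ->
  sobolev_gradient g mu par f Gf -> {ae mu, forall sigma, `|f sigma| <= N} ->
  (energy Gf < +oo)%E ->
  (entropy mu (fun sigma => (f sigma) ^+ 2)%R <=
   (16 * k.+1%:R / C)%:E * energy Gf +
   (N ^+ 2 * ((16 * a ^+ 2 * (1 + B) + 2 * (3 + 2 * B)) * 2^-1 ^+ k.+1))%:E)%E.
Proof.
move=> T0 C0 N0 su u0 lsi Gua expB sf fN Gf_fin.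
have [D8h K2D8h D8h2] := pow_bounds R k.
set D8 : R := (8 ^+ k.+1)^-1 in D8h K2D8h D8h2 *; set h := 2^-1 ^+ k.+1.
have D80 : 0 < D8 by rewrite invr_gt0 exprn_gt0.
have [mu_ _ mGu _] := su; have [mf _ mGf _] := sf.
have expR0 x : (0 <= (expR (C * u x ^+ 2))%:E)%E by rewrite lee_fin expR_ge0.
have B0 : 0 <= B by rewrite -lee_fin (le_trans _ expB)// integral_ge0.
pose q : R := C / (8 * k.+1%:R).
have q0 : 0 < q by rewrite divr_gt0// mulr_gt0.
have c0 : 0 < q ^+ k.+1 by rewrite exprn_gt0.
(* the truncation then costs [2 * l * N ^+ 4 = N ^+ 2 * D8], like the cutoff *)
pose l := D8 / (2 * N ^+ 2).
have l0 : 0 < l by rewrite divr_gt0// mulr_gt0// exprn_gt0.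
have [e e0 we] := near_zero_integral_small mu_ D80 u0.
have mz : measurable_fun setT (fun x => near_infty (q ^+ k.+1) k (u x)).
  apply: measurableT_comp mu_; apply: continuous_measurable_fun.
  exact: near_infty_continuous.
have pexp : nonneg_mfun (fun x => (expR (C * u x ^+ 2))%:E).
  split=> //; apply/measurable_EFinP; apply: measurableT_comp.
    exact: measurable_expR.
  by apply: measurable_funM; [exact: measurable_cst|exact: measurable_funX].
have pz : nonneg_mfun (fun x => (near_infty (q ^+ k.+1) k (u x))%:E).
  by split=> [|x]; [exact/measurable_EFinP|rewrite lee_fin near_infty_ge0].
have zB : (\int[mu]_x (near_infty (q ^+ k.+1) k (u x))%:E <= (D8 * B)%:E)%E.
  have D80' := ltW D80.
  have D80E : (0 <= D8%:E)%E by rewrite lee_fin.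
  rewrite EFinM; apply: (le_trans _ (lee_wpmul2l D80E expB)).
  rewrite -(integral_nonnegZ _ D80' pexp); apply: integral_nonneg_le => //.
    exact: nonneg_mfunM (nonneg_mfun_cst _ D80') pexp.
  by apply: nearW => x; rewrite -EFinM lee_fin; exact: near_infty_le_expR.
have tphi := test_function_trunc l0.
have ttheta := test_function_cutoff k e0 c0.
have Gu_fin : (energy Gu < +oo)%E.
  apply: le_lt_trans (integral_cst_lty mu (a ^+ 2)).
  apply: integral_nonneg_le Gua; first exact: nonneg_mfun_nrm2.
  exact/nonneg_mfun_cst/sqr_ge0.
have sv := sobolev_gradient_mul T0 tphi ttheta sf Gf_fin su Gu_fin.
set v := (fun sigma => _) in sv; set Gv := (fun sigma s => _) in sv.
have vfin : finite_norm mu +oo v.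
  have [b1 b10 pB] := test_bounded tphi.
  have [b2 b20 tB] := test_bounded ttheta.
  apply: (@bounded_finite_norm _ (b1 * b2)) => x.
  by rewrite normrM ler_pM// ?(pB _).1 ?(tB _).1.
have [mv _ _ _] := sv.
have iz : mu.-integrable setT
    (EFin \o (fun x => near_infty (q ^+ k.+1) k (u x))).
  apply/integrableP; split; first exact/measurable_EFinP.
  under eq_integral => x _ do rewrite gee0_abs ?(pz.2 x)//.
  by apply: le_lt_trans zB _; exact: ltry.
have iw : mu.-integrable setT (EFin \o (fun x => near_zero e (u x))).
  apply: (@integrable_ae_bounded _ _ _ mu _ 1).
    apply: measurableT_comp mu_; apply: continuous_measurable_fun.
    exact: near_zero_continuous.
  by apply: nearW => x; rewrite ger0_norm ?near_zero_le1 ?near_zero_ge0.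
have mass : \int[mu]_x (f x) ^+ 2 - \int[mu]_x (v x) ^+ 2 <=
    N ^+ 2 * ((3 + 2 * B) * D8).
  have wD8 : \int[mu]_x near_zero e (u x) <= D8.
    by rewrite -lee_fin -integral_EFin.
  have zD8 : \int[mu]_x near_infty (q ^+ k.+1) k (u x) <= D8 * B.
    by rewrite -lee_fin -integral_EFin.
  apply: (le_trans (mass_defect_le l0 e0 c0 mf mu_ fN iz)).
  have -> : 2 * l * N ^+ 4 = N ^+ 2 * D8 by rewrite /l; field; rewrite gt_eqF.
  have -> : N ^+ 2 * ((3 + 2 * B) * D8) =
    N ^+ 2 * D8 + 2 * N ^+ 2 * (D8 + D8 * B) by ring.
  rewrite lerD2l; apply: ler_wpM2l; last exact: lerD.
  exact: mulr_ge0 (ler0n _ 2) (sqr_ge0 _).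
have energy_side : (entropy mu (fun x => v x ^+ 2)%R <=
    (16 * k.+1%:R / C)%:E * energy Gf +
    (N ^+ 2 * (16 * a ^+ 2 * (1 + B) * h))%:E)%E.
  apply: (le_trans (lsi v Gv sv vfin)).
  apply: (le_trans (energy_cutoff_le erefl l0 e0 q0 mf mu_ mGf mGu fN Gua)).
  have -> : 16 * k.+1%:R / C = 2 * q^-1.
    have K0 : k.+1%:R != 0 :> R by rewrite pnatr_eq0.
    by rewrite /q; move: (k.+1%:R) K0 => j j0; field; rewrite ?j0 ?gt_eqF.
  have K20 : (0 <= (k.+1%:R ^+ 2)%:E :> \bar R)%E by rewrite lee_fin sqr_ge0.
  have A0 : 0 <= 16 * N ^+ 2 * a ^+ 2.
    by apply: mulr_ge0 (sqr_ge0 _); exact: mulr_ge0 (ler0n _ 16) (sqr_ge0 _).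
  have A0' : (0 <= (16 * N ^+ 2 * a ^+ 2)%:E)%E by rewrite lee_fin.
  apply: leeD => //.
  apply: (le_trans (lee_wpmul2l A0' (leeD we (lee_wpmul2l K20 zB)))).
  rewrite -EFinM lee_fin.
  have -> : N ^+ 2 * (16 * a ^+ 2 * (1 + B) * h) =
    16 * N ^+ 2 * a ^+ 2 * (h + h * B) by ring.
  by rewrite ler_wpM2l// lerD// mulrA ler_wpM2r.
have N20 : 0 < N ^+ 2 by rewrite exprn_gt0.
have ent := @entropy_le _ _ _ mu (fun x => (f x) ^+ 2) (fun x => (v x) ^+ 2)
  (N ^+ 2) N20 (measurable_funX _ mf) (measurable_funX _ mv).
apply: le_trans (ent _) _.
  apply: filterS fN => x fx.
  split; [exact: sqr_ge0|exact: sqr_cut_le|exact: le_sqr_norm].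
apply: le_trans (leeD energy_side (lexx _)) _.
rewrite -addeA leeD2l// -EFinD lee_fin.
rewrite [in leRHS]mulrDl mulrDr lerD2l.
have -> : N ^+ 2 * (2 * (3 + 2 * B) * h) = 2 * (N ^+ 2 * ((3 + 2 * B) * h)).
  by ring.
rewrite ler_pM2l//.
have h0 : 0 <= h by rewrite exprn_ge0// invr_ge0.
have B3 : 1 <= 3 + 2 * B by rewrite -[leLHS]addr0 lerD ?ler1n// mulr_ge0.
have B30 : 0 <= 3 + 2 * B := le_trans ler01 B3.
have r0 : 0 <= N ^+ 2 * ((3 + 2 * B) * h).
  exact: mulr_ge0 (ltW N20) (mulr_ge0 B30 h0).
rewrite -[leRHS]ger0_norm// -sqrtr_sqr ler_wsqrtr//.
apply: (@le_trans _ _ (N ^+ 2 * ((3 + 2 * B) * D8) * N ^+ 2)).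
  by rewrite ler_pM2r.
have -> : (N ^+ 2 * ((3 + 2 * B) * h)) ^+ 2 =
  N ^+ 2 * ((3 + 2 * B) * ((3 + 2 * B) * h ^+ 2)) * N ^+ 2 by ring.
rewrite ler_pM2r// ler_pM2l// ler_wpM2l//.
by rewrite (le_trans D8h2)// ler_peMl// sqr_ge0.
Qed.

End WeakLogSobolev.

(** [|ln s|] exceeds 1, so it absorbs the constant [A] and the rounding. *)
Lemma pow_half_le_exp (R : realType) (A s : R) : 0 <= A -> 0 < s < expR (-1) ->
  exists k : nat, k.+1%:R <= (3 + 2 * A) * `|ln s| /\ A * 2^-1 ^+ k.+1 <= s.
Proof.
move=> A0 /andP[s0 s1].
have lns : ln s < -1 by rewrite -[ltRHS]expRK ltr_ln ?posrE// expR_gt0.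
have -> : `|ln s| = - ln s by rewrite ltr0_norm// (lt_trans lns)// oppr_lt0.
set lam := - ln s.
have lam1 : 1 < lam by rewrite /lam ltrNr.
pose x := 2 * (1 + A) * lam.
have x0 : 0 <= x.
  by rewrite mulr_ge0 ?mulr_ge0 ?addr_ge0// ltW// (lt_trans ltr01).
exists (Num.truncn x); have /andP[tx xt] := truncn_itv x0.
split.
  rewrite -natr1 (le_trans (lerD tx (ltW lam1)))// /x; lra.
have sE : s = expR (- lam) by rewrite /lam opprK lnK.
have half : 2^-1 <= expR (- 2^-1) :> R.
  have := expR_ge1Dx (- 2^-1 : R); apply: le_trans; lra.
apply: (@le_trans _ _ (expR A * expR (- 2^-1) ^+ (Num.truncn x).+1)).
  apply: ler_pM; [by []|by rewrite exprn_ge0// invr_ge0| |].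
    by apply: (le_trans _ (expR_ge1Dx A)); rewrite lerDr.
  by rewrite lerXn2r ?nnegrE ?expR_ge0// invr_ge0.
rewrite -expRM_natl -expRD sE ler_expR.
have : A <= A * lam by rewrite ler_peMr// ltW.
move: xt; rewrite /x => xt; lra.
Qed.

Theorem proposition3p1 (R : realType) (n : nat) (M : metricType R)
    (S : smooth_structure n M) (g : riemannian_metric S)
    (D : skew_connection g) (T : R) (x0 : M)
    (mu : probability (path_space T x0) R)
    (par : path_space T x0 -> R -> 'M[R]_n)
    (hT : 0 < T)
    (hM : stochastically_complete g)
    (hpar : parallel_translation D mu par)
    (hclos : gradient_closable g mu par)
    (u : path_space T x0 -> R) (Gu : path_space T x0 -> R -> 'rV[R]_n)
    (hu : sobolev_gradient g mu par u Gu)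
    (upos : {ae mu, forall sigma, 0 < u sigma})
    (hlsi : forall f Gf, sobolev_gradient g mu par f Gf ->
       finite_norm mu +oo f ->
       (entropy mu (fun sigma => (f sigma) ^+ 2)%R <=
        \int[mu]_sigma (((u sigma) ^+ 2)%:E * cm_norm2 g T x0 (Gf sigma)))%E)
    (a C : R) (ha : 0 < a) (hC : 0 < C)
    (hGu : {ae mu, forall sigma,
       (cm_norm2 g T x0 (Gu sigma) <= (a ^+ 2)%:E)%E})
    (hexp : (\int[mu]_sigma (expR (C * (u sigma) ^+ 2))%:E < +oo)%E) :
  exists (C' r0 : R) (beta : R -> R),
    [/\ 0 < C', 0 < r0,
        (forall s, 0 < s -> 0 <= beta s),
        (forall s, 0 < s < r0 -> beta s = C' * `|ln s|) &
        forall f Gf, sobolev_gradient g mu par f Gf ->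
          finite_norm mu +oo f ->
          forall s, 0 < s ->
          (entropy mu (fun sigma => (f sigma) ^+ 2)%R <=
           (beta s)%:E * \int[mu]_sigma cm_norm2 g T x0 (Gf sigma) +
           s%:E * 'N[mu]_+oo[EFin \o f] ^+ 2)%E].
Proof.
pose B := fine (\int[mu]_sigma (expR (C * (u sigma) ^+ 2))%:E)%E.
have exp0 : (0 <= \int[mu]_sigma (expR (C * (u sigma) ^+ 2))%:E)%E.
  by apply: integral_ge0 => x _; rewrite lee_fin expR_ge0.
have expB : (\int[mu]_sigma (expR (C * (u sigma) ^+ 2))%:E <= B%:E)%E.
  by rewrite /B fineK// ge0_fin_numE.
have B0 : 0 <= B by exact: fine_ge0.
pose A := 16 * a ^+ 2 * (1 + B) + 2 * (3 + 2 * B).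
have A0 : 0 <= A.
  apply: addr_ge0; last by rewrite mulr_ge0// addr_ge0// mulr_ge0.
  apply: mulr_ge0; last exact: addr_ge0.
  exact: mulr_ge0 (ler0n _ 16) (sqr_ge0 _).
pose C' := 16 * (3 + 2 * A) / C.
have C'0 : 0 < C' by rewrite divr_gt0// mulr_gt0// ltr_pwDl// mulr_ge0.
pose r0 : R := expR (-1).
have r00 : 0 < r0 by exact: expR_gt0.
have r1 : r0 / 2 < r0 by rewrite ltr_pdivrMr// mulr_natr mulr2n ltrDl.
pose beta s := if s < r0 then C' * `|ln s| else C' * `|ln (r0 / 2)|.
have r20 : 0 < r0 / 2 by rewrite divr_gt0.
have ln_neq0 s : 0 < s -> s < r0 -> 0 < `|ln s|.
  move=> s0 sr; rewrite normr_gt0 lt_eqF// (@lt_trans _ _ (-1))//.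
  by rewrite -[ltRHS]expRK ltr_ln ?posrE.
exists C', r0, beta; split => //.
- by move=> s s0; rewrite /beta; case: ifP => _; rewrite mulr_ge0// ltW.
- by move=> s /andP[s0 sr]; rewrite /beta sr.
move=> f Gf sf ffin.
have [mf _ mGf _] := sf.
have I0 : (0 <= \int[mu]_sigma cm_norm2 g T x0 (Gf sigma))%E.
  by apply: integral_ge0 => x _; exact: cm_norm2_ge0.
have small s : 0 < s < r0 -> (entropy mu (fun sigma => (f sigma) ^+ 2)%R <=
    (C' * `|ln s|)%:E * \int[mu]_sigma cm_norm2 g T x0 (Gf sigma) +
    s%:E * 'N[mu]_+oo[EFin \o f] ^+ 2)%E.
  move=> sr0; have /andP[s0 sr] := sr0.
  have [N N0 [-> fN]] := ae_norm_le_Lnorm ffin.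
  rewrite -EFin_expe -EFinM.
  (* as [beta s > 0], an infinite energy makes the right-hand side infinite *)
  have [Ify|Iy] := eqVneq (\int[mu]_sigma cm_norm2 g T x0 (Gf sigma))%E +oo%E.
    rewrite Ify gt0_muley; last by rewrite lte_fin mulr_gt0// ln_neq0.
    by rewrite addye// leey.
  have Ifin : (\int[mu]_sigma cm_norm2 g T x0 (Gf sigma) < +oo)%E.
    by rewrite lt_neqAle Iy leey.
  move: N0; rewrite le_eqVlt => /orP[/eqP N0|N0].
    rewrite (_ : entropy _ _ = 0%E); last first.
      rewrite (@eq_ae_entropy _ _ _ mu _ (cst 0)).
      - rewrite /entropy; under eq_integral do rewrite mul0r.
        by rewrite integral0.
      - exact: measurable_funX.
      - exact: measurable_cst.
      apply: filterS fN => x; rewrite -N0 normr_le0 => /eqP ->.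
      by rewrite expr0n.
    rewrite adde_ge0// ?mule_ge0// lee_fin; first by rewrite mulr_ge0// ltW.
    by rewrite mulr_ge0 ?sqr_ge0// ltW.
  have [k [kle Ale]] := pow_half_le_exp A0 sr0.
  apply: (le_trans (entropy_le_energy k (ltW hT) hC N0 hu upos hlsi hGu expB
    sf fN Ifin)).
  apply: leeD.
    apply: lee_wpmul2r => //.
    rewrite lee_fin /C' [leRHS]mulrAC ler_pM2r ?invr_gt0//.
    by rewrite -mulrA ler_pM2l.
  by rewrite lee_fin [N ^+ 2 * _]mulrC ler_pM2r ?exprn_gt0.
move=> s s0; rewrite /beta; case: ifPn => [sr|].
  by apply: small; rewrite s0.
(* for large [s] the inequality at [r0 / 2] is stronger *)
rewrite -leNgt => rs.
apply: (le_trans (small (r0 / 2) _)); first by rewrite r20.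
apply: leeD => //; apply: lee_wpmul2r.
  by rewrite sqre_ge0.
by rewrite lee_fin (le_trans (ltW r1)).
Qed.
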